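(* A finite simple graph $\Gamma$ is isomorphic to the prime graph of a pseudo $U_4(2)$-solvable group if and only if its complement $\overline{\Gamma}$ is $3$-colorable and triangle-free.
   Context: All groups are finite and all graphs are simple. For a finite group $G$, the prime graph $\Gamma(G)$ has as vertices the prime divisors of $|G|$; two distinct vertices $p,q$ are adjacent if and only if $G$ contains an element of order $pq$. $U_4(2)$ is the projective special unitary group of degree $4$ over the field with $2^2$ elements (a simple group of order $2^6\cdot 3^4\cdot 5$). A group is pseudo $U_4(2)$-solvable if each of its composition factors is abelian or isomorphic to $U_4(2)$ (in particular solvable groups are allowed). *)

(* Defs.v *)
From mathcomp Require Import all_boot all_fingroup all_algebra all_solvable.
From mathcomp Require Import all_field.

Set Implicit Arguments.
Unset Strict Implicit.
Unset Printing Implicit Defensive.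

Import GRing.Theory.
Local Open Scope group_scope.

Record sgraph := SGraph {
  vertex :> finType;
  adj : rel vertex;
  adj_sym : symmetric adj;
  adj_irrefl : irreflexive adj
}.

Definition graph_iso (X Y : sgraph) : Prop :=
  exists2 f : X -> Y, bijective f & {mono f : x y / adj x y}.

Section Complement.

Variable X : sgraph.

Definition compl_adj : rel X := [rel x y | (x != y) && ~~ adj x y].

Fact compl_adj_sym : symmetric compl_adj.
Proof. by move=> x y; rewrite /compl_adj /= eq_sym adj_sym. Qed.

Fact compl_adj_irrefl : irreflexive compl_adj.
Proof. by move=> x; rewrite /compl_adj /= eqxx. Qed.

Definition compl_graph := SGraph compl_adj_sym compl_adj_irrefl.

End Complement.

Definition colorable (k : nat) (X : sgraph) : Prop :=
  exists c : X -> 'I_k, forall x y, adj x y -> c x != c y.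

Definition triangle_free (X : sgraph) : Prop :=
  forall x y z : X, ~~ [&& adj x y, adj y z & adj x z].

Section PrimeGraph.

Variables (gT : finGroupType) (G : {group gT}).

Definition prime_adj : rel (seq_sub (primes #|G|)) :=
  [rel p q | (p != q) && [exists x in G, #[x] == (val p * val q)%N]].

Fact prime_adj_sym : symmetric prime_adj.
Proof. by move=> p q; rewrite /prime_adj /= eq_sym mulnC. Qed.

Fact prime_adj_irrefl : irreflexive prime_adj.
Proof. by move=> p; rewrite /prime_adj /= eqxx. Qed.

Definition prime_graph := SGraph prime_adj_sym prime_adj_irrefl.

End PrimeGraph.

(* The special unitary group of the Hermitian form \sum_i x_i * sigma y_i, for *)
(* a field automorphism sigma of order 2. All nondegenerate Hermitian forms of *)
(* a given dimension over a finite field are equivalent, so the choice of the  *)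
(* form does not matter up to isomorphism.                                     *)
Section Unitary.

Variables (n : nat) (F : finFieldType) (sigma : {rmorphism F -> F}).

Definition SU : {set {'GL_n[F]}} :=
  [set A : {'GL_n[F]} |
    (GLval A *m (map_mx sigma (GLval A))^T == 1%:M)%R & (\det (GLval A) == 1)%R].

Fact SU_group_set : group_set SU.
Proof.
apply/group_setP; split=> [|A B].
  by rewrite inE GL_1E map_mx1 trmx1 mulmx1 det1 !eqxx.
rewrite !inE => /andP[/eqP uA /eqP dA] /andP[/eqP uB /eqP dB].
rewrite GL_MxE det_mulmx dA dB mulr1 eqxx andbT map_mxM trmx_mul.
by rewrite -mulmxA (mulmxA (GLval B)) uB mul1mx uA.
Qed.

Canonical SU_group := Group SU_group_set.

Definition PSU : {group coset_of 'Z(SU)} := (SU / 'Z(SU))%G.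

End Unitary.

Definition F4 : finFieldType :=
  s2val (pPrimePowerField (isT : prime 2) (isT : 0 < 2)).

Fact pchar_F4 : 2 \in [pchar F4]%R.
Proof. exact: s2valP (pPrimePowerField _ _). Qed.

Fact card_F4 : #|F4| = 4.
Proof. exact: s2valP' (pPrimePowerField _ _). Qed.

(* The squaring map is the automorphism of order 2 of F4. *)
Definition U42 := PSU 4 (pFrobenius_aut pchar_F4).

(* By exists_comps and JordanHolderUniqueness, ranging over all composition    *)
(* series amounts to using any one of them.                                    *)
Definition pseudo_U42_solvable (gT : finGroupType) (G : {group gT}) : Prop :=
  forall s : seq {group gT}, comps G s ->
  forall f : section gT, f \in mkfactors G s -> abelian f \/ f \isog U42.

(* Main.v *)
(* Nonadjacent primes p <> q of G are compared by their depth in a chief series: pos p is the last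
   n such that p does not divide |G : K_n|. On a set of primes of which every chief factor involves
   at most one (all of them if G is solvable, those >= 5 if G is pseudo U_4(2)-solvable), pos is
   injective. Repeated Frattini arguments produce, from p, q, r, s in increasing position, nontrivial
   subgroups S, R, Q and an element x of order p such that Q and x normalise R, etc. If consecutive
   primes are nonadjacent, then R has rank one, so [x, Q] centralises Ohm_1(R), which is impossible;
   hence colouring a prime by whether it is a source, a sink or neither in the oriented complement
   uses 3 colours. Nonadjacency of p, q, r would give a Frobenius group of order pq acting fixed point
   freely on an r-group, which is impossible too. If U_4(2) is a composition factor, 2 and 3 are
   adjacent to each other and to all primes >= 7, so they hang at 5 and harm neither property. This
   needs that U_4(2) has order 2^6 3^4 5, subgroups 2^3 and 3^2, an element of order 6, and an element
   of order 3 whose centraliser has Sylow 2-subgroups of order 2.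

   Conversely a graph is realised by a solvable group, built one vertex at a time in the order of the
   colours 0, 1, 2, with primes congruent to 1 modulo the relevant earlier ones. Colour 0 gives a
   cyclic group. A new prime r is added by letting the group K already built act on the module over
   F_r induced from a linear character lam of L <| K: an element x of prime order p is fixed point
   free on it if and only if x lies in L and lam x <> 1. For colour 1, L = K and the kernel of lam
   involves exactly the adjacent primes of colour 0; for colour 2, L cuts out the adjacent primes
   of colour 0 and lam is nontrivial on the nonadjacent primes of colours 0 and 1, where triangle
   freeness is what makes lam multiplicative on L. *)

From HB Require Import structures.
From mathcomp Require Import all_boot all_fingroup all_algebra all_solvable.
From mathcomp Require Import all_field zify.
Require Import Defs.

Set Implicit Arguments.
Unset Strict Implicit.
Unset Printing Implicit Defensive.
Import GRing.Theory.

(** * Primes congruent to 1 modulo n *)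

Section PrimesOneMod.

Local Open Scope ring_scope.

(** [Q] is a nonzero polynomial, so one of [size Q] distinct multiples of [b] is not a root of it,
    and there ['Phi_n] differs from 1 and -1. It differs from 0 as well, because its value divides
    [(b k)^n - 1]. *)
Lemma exists_Cyclotomic_large n (b : nat) : (0 < n)%N -> (0 < b)%N ->
  exists2 k : nat, (1 < k)%N & (1 < `|('Phi_n).[(b * k)%:Z]|)%N.
Proof.
move=> n_gt0 b_gt0; have sPhi := size_Cyclotomic n.
have tot_gt0 : (0 < totient n)%N by rewrite totient_gt0.
pose Q := 'Phi_n ^+ 2 - 1 : {poly int}.
have nzP : 'Phi_n != 0 :> {poly int} by rewrite -size_poly_eq0 sPhi.
have nzQ : Q != 0.
  rewrite subr_eq0; apply: contraTneq tot_gt0 => Q0.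
  have := congr1 (fun p : {poly int} => size p) Q0; rewrite size_poly1 expr2 size_mul // sPhi.
  by case: (totient n) => // m; rewrite addnS.
pose rs := [seq (b * k)%:Z | k <- iota 2 (size Q)].
have [k k_rs nzk] : exists2 k, k \in iota 2 (size Q) & Q.[(b * k)%:Z] != 0.
  have : ~~ all (root Q) rs.
    apply/negP => allQ; suffices: (size rs < size Q)%N by rewrite size_map size_iota ltnn.
    apply: max_poly_roots nzQ allQ _; rewrite map_inj_uniq ?iota_uniq // => x y [/eqP].
    by rewrite eqn_pmul2l // => /eqP.
  by case/allPn => [_ /mapP[k k_rs ->] nzk]; exists k.
move: k_rs; rewrite mem_iota => /andP[k2 _]; exists k => //.
have bk2 : (1 < b * k)%N by rewrite (leq_trans k2) // leq_pmull.
have nz : ('Phi_n).[(b * k)%:Z] != 0 :> int.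
  have := congr1 (fun p : {poly int} => p.[(b * k)%:Z]) (prod_Cyclotomic n_gt0).
  rewrite hornerD hornerN hornerC hornerXn horner_prod => E.
  have : \prod_(d <- divisors n) ('Phi_d).[(b * k)%:Z] != 0 :> int.
    rewrite E subr_eq0; apply/eqP => /(congr1 absz); rewrite abszX /= => /eqP.
    by rewrite -(exp1n n) eqn_exp2r // gtn_eqF.
  by rewrite (big_rem n) /= ?divisors_id // mulf_eq0 => /norP[].
rewrite ltn_neqAle eq_sym lt0n absz_eq0 nz andbT.
apply: contra nzk => /eqP P1; rewrite !hornerE.
rewrite subr_eq0 sqrf_eq1; move: P1; case: (_.[_]) => [[|[|]]|[|]] //.
Qed.

(** A prime [p] dividing the value of ['Phi_n] at a multiple [a] of [n m!] does not divide [a],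
    since [a^n = 1] modulo [p]; hence [p > m] and [p] does not divide [n]. Then [X^n - 1] is
    separable modulo [p], so [a] is a root of no ['Phi_e] with [e] a proper divisor of [n], and has
    order exactly [n] modulo [p]. *)
Lemma exists_prime_1mod n m : (0 < n)%N -> exists p, [/\ prime p, (m < p)%N & (n %| p.-1)%N].
Proof.
move=> n_gt0; have b_gt0 : (0 < n * m`!)%N by rewrite muln_gt0 n_gt0 fact_gt0.
have [k k2 lt1] := exists_Cyclotomic_large n_gt0 b_gt0.
set a := (n * m`! * k)%N in lt1; set P := ('Phi_n).[a%:Z] in lt1.
pose p := pdiv `|P|; have p_pr : prime p by rewrite pdiv_prime.
have pP : (p %| `|P|)%N by apply: pdiv_dvd.
have charp : p \in [pchar 'F_p] := pchar_Fp p_pr.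
have int0 (z : int) : (p %| `|z|)%N -> z%:~R = 0 :> 'F_p.
  by move=> pz; apply/eqP; rewrite -(dvdz_pcharf charp).
pose al : 'F_p := a%:R; pose Phi d : {poly 'F_p} := map_poly intr 'Phi_d.
have Phi_root : root (Phi n) al.
  have al_a : al = (a%:Z)%:~R by [].
  by apply/rootP; rewrite /Phi al_a horner_map; apply: int0.
have Phi_prod d : (0 < d)%N -> \prod_(e <- divisors d) Phi e = 'X^d - 1.
  move=> d_gt0; rewrite -(rmorph_prod (map_poly intr)) prod_Cyclotomic //.
  by rewrite rmorphB rmorph1 /= map_polyXn.
have al_n : al ^+ n = 1.
  have: root ('X^n - 1) al.
    by rewrite -Phi_prod // (big_rem n) ?divisors_id //= rootM Phi_root.
  by rewrite rootE !hornerE subr_eq0 => /eqP.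
have nz_a : a%:R != 0 :> 'F_p.
  by apply/eqP => a0; move/eqP: al_n; rewrite /al a0 expr0n gtn_eqF // eq_sym oner_eq0.
have p_a : ~~ (p %| a)%N by rewrite (dvdn_pcharf charp).
have p_n : ~~ (p %| n)%N by apply: contra p_a => pn; rewrite /a -mulnA dvdn_mulr.
have m_p : (m < p)%N.
  rewrite ltnNge; apply: contra p_a => p_m; rewrite /a dvdn_mulr // dvdn_mull //.
  by rewrite dvdn_fact // prime_gt0.
exists p; split=> //.
have [d al_d d_n] := prim_order_exists n_gt0 al_n.
have d_gt0 := prim_order_gt0 al_d.
have [<-|nd] := eqVneq d n.
  rewrite (prim_order_dvd al_d) -(inj_eq (mulfI nz_a)) mulr1 -exprS prednK ?prime_gt0 //.
  by have := expf_card al; rewrite card_Fp // => ->.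
have lt_dn : (d < n)%N by rewrite ltn_neqAle nd dvdn_leq.
have [e e_d Phi_e] : exists2 e, e \in divisors d & root (Phi e) al.
  have: root (\prod_(e <- divisors d) Phi e) al.
    by rewrite Phi_prod // rootE !hornerE (prim_expr_order al_d) subrr.
  rewrite rootE horner_prod prodf_seq_eq0 => /hasP[e e_d /= Phi_e]; exists e => //.
have ne_en : e != n.
  by rewrite neq_ltn (leq_ltn_trans _ lt_dn) // dvdn_leq // dvdn_divisors.
have e_n : e \in rem n (divisors n).
  rewrite mem_rem_uniq ?divisors_uniq // !inE ne_en -dvdn_divisors //.
  by rewrite (dvdn_trans _ d_n) // dvdn_divisors.
have Xn1 : 'X^n - 1 = Phi n * (Phi e * \prod_(f <- rem e (rem n (divisors n))) Phi f).
  by rewrite -Phi_prod // (big_rem n) ?divisors_id //= (big_rem e).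
have: ('X^n - 1 : {poly 'F_p})^`().[al] = 0.
  by rewrite Xn1 derivM hornerD !hornerM (rootP Phi_root) (rootP Phi_e) !mul0r mulr0 addr0.
rewrite derivB derivXn derivC subr0 hornerMn hornerXn -mulr_natl => /eqP.
by rewrite mulf_eq0 expf_eq0 (negPf nz_a) andbF orbF -(dvdn_pcharf charp) (negPf p_n).
Qed.

End PrimesOneMod.

Lemma exists_primitive_root_Fp p n : prime p -> 0 < n -> n %| p.-1 ->
  exists w : 'F_p, (n.-primitive_root w)%R.
Proof.
move=> p_pr n_gt0 n_p1; have p1_gt0 : 0 < p.-1 by rewrite -subn1 subn_gt0 prime_gt1.
pose rs := enum (predC1 (0 : 'F_p)%R).
have rs_size : size rs = p.-1 by rewrite -cardE cardC1 card_Fp.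
have /hasP[w _ prim_w] : has (fun w : 'F_p => (p.-1).-primitive_root w)%R rs.
  apply: has_prim_root; rewrite ?rs_size ?enum_uniq //.
  apply/allP => x; rewrite mem_enum => nz_x; apply/unity_rootP/(mulfI nz_x).
  by rewrite mulr1 -exprS prednK ?prime_gt0 // -{2}(expf_card x) card_Fp.
by exists (w ^+ (p.-1 %/ n))%R; apply: dvdn_prim_root.
Qed.

(** Each new prime exceeds the sum of those chosen before, which makes the choice injective on [A].
    The bound [B] and the modulus [n] serve to treat the three colours one after the other. *)
Lemma prime_labelling (T : finType) (A : {pred T}) (n B : nat) : 0 < n ->
  exists f : T -> nat, [/\ {in A &, injective f}, forall x, prime (f x),
    forall x, B < f x & forall x, n %| (f x).-1].
Proof.
move=> n_gt0; suffices [f [f_inj f_pr fB fn]] : exists f : T -> nat, [/\ {in enum A &, injective f},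
    forall x, prime (f x), forall x, B < f x & forall x, n %| (f x).-1].
  by exists f; split=> // x y Ax Ay; apply: f_inj; rewrite mem_enum.
elim: (enum A) => [|a s [f [f_inj f_pr fB fn]]].
  by have [p [p_pr Bp np]] := exists_prime_1mod B n_gt0; exists (fun=> p).
have [p [p_pr Bp np]] := exists_prime_1mod (B + \sum_(x <- s) f x) n_gt0.
have lt_p x : x \in s -> f x < p.
  by move=> sx; apply: leq_ltn_trans Bp; rewrite (big_rem x) //= addnCA leq_addr.
exists (fun x => if x == a then p else f x); split=> [x y|x|x|x]; try by case: ifP.
- rewrite !inE; case: eqVneq => [->|_]; case: eqVneq => [->|_] //= sx sy.
  + by move=> pf; have := lt_p y sy; rewrite -pf ltnn.
  + by move=> pf; have := lt_p x sx; rewrite pf ltnn.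
  + exact: f_inj.
- by case: ifP => // _; apply: leq_ltn_trans Bp; apply: leq_addr.
Qed.

Local Open Scope group_scope.

(** * The group U_4(2) *)

(* (a, b) stands for a + b omega in F_4, omega being a root of 1 + X + X^2. *)
Definition code := (bool * bool)%type.
Definition c0 : code := (false, false).
Definition c1 : code := (true, false).
Definition cw : code := (false, true).
Definition cv : code := (true, true).
Definition cadd (x y : code) : code := (x.1 (+) y.1, x.2 (+) y.2).
Definition cmul (x y : code) : code :=
  ((x.1 && y.1) (+) (x.2 && y.2), (x.1 && y.2) (+) (x.2 && y.1) (+) (x.2 && y.2)).
Definition cconj (x : code) : code := (x.1 (+) x.2, x.2).
Definition ceq (x y : code) := ~~ (x.1 (+) y.1) && ~~ (x.2 (+) y.2).

Lemma ceqE x y : ceq x y = (x == y).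
Proof. by case: x y => [[] []] [[] []]. Qed.

Definition dotc (u v : seq code) : code :=
  foldr (fun p a => cadd (cmul p.1 p.2) a) c0 (zip u v).
Definition herm (u v : seq code) := dotc u (map cconj v).

Definition mulc (n : nat) (s t : seq (seq code)) : seq (seq code) :=
  [seq [seq dotc u (map (nth c0 ^~ j) t) | j <- iota 0 n] | u <- s].

Fixpoint vecs (n : nat) : seq (seq code) :=
  if n is n'.+1 then [seq x :: v | x <- [:: c0; c1; cw; cv], v <- vecs n'] else [:: [::]].

Definition orthc (v u : seq code) := ceq (herm u v) c0.

(** With lists of unit vectors these are the orthonormal frames, that is, the rows of unitary
    matrices. Choosing a row filters the lists from which the later rows are taken. *)
Fixpoint frames (k : nat) (Us : seq (seq (seq code))) : seq (seq (seq code)) :=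
  match k, Us with
  | k'.+1, U :: Us' =>
    flatten [seq map (cons v) (frames k' (map (filter (orthc v)) Us')) | v <- U]
  | _, _ => [:: [::]]
  end.

(* Listing the 77760 frames is too expensive for the kernel, counting them is not. *)
Fixpoint nframes (k : nat) (Us : seq (seq (seq code))) : nat :=
  match k, Us with
  | k'.+1, U :: Us' => sumn [seq nframes k' (map (filter (orthc v)) Us') | v <- U]
  | _, _ => 1
  end.

Lemma mem_vecs n v : (v \in vecs n) = (size v == n).
Proof.
elim: n v => [|n IH] [|x v] //.
  by apply/allpairsPdep => -[y [w [_ _]]].
rewrite eqSS -IH; apply/allpairsPdep/idP => [[y [w [_ vw [_ ->]]]] //|vv].
by exists x, v; split=> //; case: (x) => [[] []].
Qed.

Lemma uniq_vecs n : uniq (vecs n).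
Proof.
elim: n => [|n IH] //; apply: (@allpairs_uniq _ _ _ (fun x v => x :: v)) => //.
by move=> [x v] [y w] _ _ /= [-> ->].
Qed.

Lemma size_frames k Us : size (frames k Us) = nframes k Us.
Proof.
elim: k Us => // k IH [|U Us] //=; rewrite size_flatten /shape -map_comp; congr sumn.
by apply: eq_map => v /=; rewrite size_map.
Qed.

Lemma uniq_frames k Us : all uniq Us -> uniq (frames k Us).
Proof.
elim: k Us => // k IH [|U Us] //= /andP[uU uUs].
have uF v : uniq (frames k (map (filter (orthc v)) Us)).
  by apply: IH; rewrite all_map; apply: sub_all uUs => W /=; apply: filter_uniq.
elim: U uU => //= v U IHU /andP[nvU uU]; rewrite cat_uniq IHU // andbT.
rewrite map_inj_uniq ?uF //; last by move=> x y [].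
apply/hasPn => s /flatten_mapP[u uU' /mapP[s' _ ->]] /=; apply/mapP => -[s'' _ [Euv _]].
by rewrite -Euv uU' in nvU.
Qed.

Lemma mem_frames k Us s : size Us = k ->
  (s \in frames k Us) = all2 (fun v U => v \in U) s Us && pairwise orthc s.
Proof.
elim: k Us s => [|k IH] [|U Us] [|v s] //= [sUs].
  by apply/flatten_mapP => -[v _ /mapP[]].
transitivity ((v \in U) && (s \in frames k (map (filter (orthc v)) Us))).
  apply/flatten_mapP/andP => [[u uU /mapP[s' Fs' [-> ->]]] //|[vU Fs]].
  by exists v => //; apply/mapP; exists s.
rewrite IH ?size_map // -!andbA; congr (_ && _); rewrite !andbA; congr (_ && _).
elim: s Us {sUs} => [|u s IHs] [|W Us] //=; rewrite ?andbF // IHs mem_filter.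
by rewrite -!andbA; do !bool_congr.
Qed.

Lemma card_index3 (gT : finGroupType) (G S : {group gT}) d :
    S \subset G -> d \in G -> d \notin S -> d * d * d = 1 ->
    {in G, forall a, [|| a \in S, a * d^-1 \in S | a * (d * d)^-1 \in S]} ->
  #|G| = (#|S| * 3)%N.
Proof.
move=> sSG Gd S'd d3 GS; have od : #[d] = 3.
  apply: nt_prime_order => //; first by rewrite !expgS expg0 mulg1 mulgA.
  by apply: contraNneq S'd => ->.
have tiSd : S :&: <[d]> = 1.
  by rewrite setIC prime_TIg -?orderE ?od // cycle_subG.
rewrite -od -(TI_cardMg tiSd); congr #|pred_of_set _|; apply/eqP.
rewrite eq_sym eqEsubset mul_subG ?cycle_subG //; apply/subsetP => a Ga.
have [Sa|Sa|Sa] := or3P (GS a Ga).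
- by rewrite -[a]mulg1 mem_mulg.
- by rewrite -[a](mulgKV d) mem_mulg ?cycle_id.
- by rewrite -[a](mulgKV (d * d)) mem_mulg // groupM ?cycle_id.
Qed.

(** * Unitary matrices over F_4 and their codes *)

Section OrderFour.

Variables (F : finFieldType) (charF : 2 \in [pchar F]%R) (cardF : #|F| = 4).

Local Open Scope ring_scope.

Lemma addxx (x : F) : x + x = 0.
Proof. by rewrite -mulr2n mulrn_pchar // charF. Qed.

Lemma ord4_gen_exists : exists w : F, (w != 0) && (w != 1).
Proof.
have: (#|[set (0 : F)%R; 1%R]| < #|[set: F]|)%N by rewrite cardsT cardF cards2 eq_sym oner_eq0.
rewrite ltnNge; have [|w] := boolP [exists w : F, (w != 0) && (w != 1)].
  by move/existsP.
have/forallP w01 : [forall w : F, ~~ ((w != 0) && (w != 1))] by rewrite -negb_exists.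
case/negP; apply: subset_leq_card; apply/subsetP => x _; rewrite !inE.
by move: (w01 x); rewrite negb_and !negbK.
Qed.

Definition omega : F := xchoose ord4_gen_exists.

Lemma omega_neq0 : omega != 0. Proof. by case/andP: (xchooseP ord4_gen_exists). Qed.
Lemma omega_neq1 : omega != 1. Proof. by case/andP: (xchooseP ord4_gen_exists). Qed.

Lemma omega3 : omega ^+ 3 = 1.
Proof.
have := expf_card omega; rewrite cardF exprS -[RHS]mulr1 => /(mulfI omega_neq0) ->//.
Qed.

Lemma omega2 : omega ^+ 2 = omega + 1.
Proof.
have := subrX1 omega 3; rewrite omega3 subrr => /esym/eqP.
rewrite mulf_eq0 subr_eq0 (negPf omega_neq1) /= !big_ord_recr big_ord0 /= add0r.
rewrite expr0 expr1 addrC addr_eq0 => /eqP->; rewrite [1 + _]addrC.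
by apply/eqP; rewrite eq_sym -addr_eq0 addxx.
Qed.

Definition phi (x : code) : F := x.1%:R + x.2%:R * omega.

Lemma phi0 : phi c0 = 0. Proof. by rewrite /phi mul0r addr0. Qed.
Lemma phi1 : phi c1 = 1. Proof. by rewrite /phi mul0r addr0. Qed.

Lemma natr_addb (a b : bool) : (a (+) b)%:R = a%:R + b%:R :> F.
Proof. by case: a b => [] [] //=; rewrite ?addxx ?addr0 ?add0r. Qed.

Lemma phiD x y : phi (cadd x y) = phi x + phi y.
Proof. by rewrite /phi !natr_addb mulrDl addrACA. Qed.

Lemma natr_andb (a b : bool) : (a && b)%:R = a%:R * b%:R :> F.
Proof. by case: a b => [] [] //=; rewrite ?mulr0 ?mul0r ?mulr1. Qed.

Lemma phiM x y : phi (cmul x y) = phi x * phi y.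
Proof.
rewrite /phi !natr_addb !natr_andb !mulrDl !mulrDr.
rewrite [_ * omega * (_ * omega)]mulrACA -expr2 omega2 mulrDr mulr1.
rewrite -!mulrA [omega * _]mulrC.
rewrite -!addrA; congr (_ + _); rewrite addrC -!addrA; congr (_ + _).
Qed.

Lemma phiJ x : phi (cconj x) = phi x ^+ 2.
Proof. by rewrite expr2 -phiM; congr phi; case: x => [[] []]. Qed.

Lemma phi_inj : injective phi.
Proof.
have H z : phi z = 0 -> z = c0.
  case: z => [[] []]; rewrite /phi /= ?mul0r ?mul1r ?addr0 ?add0r //.
  - by rewrite addrC -omega2 => /eqP; rewrite expf_eq0 (negPf omega_neq0).
  - by move/eqP; rewrite oner_eq0.
  - by move/eqP; rewrite (negPf omega_neq0).
move=> x y Exy; have: cadd x y = c0 by apply: H; rewrite phiD Exy addxx.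
by case: x y {Exy} => [[] []] [[] []].
Qed.

Lemma phi_bij : bijective phi.
Proof. by apply: inj_card_bij phi_inj _; rewrite cardF card_prod card_bool. Qed.

Lemma phi_dotc u v : phi (dotc u v) = \sum_(i < minn (size u) (size v)) phi (nth c0 u i) * phi (nth c0 v i).
Proof.
elim: u v => [|x u IH] [|y v]; rewrite ?min0n ?minn0 ?big_ord0 ?phi0 //.
by rewrite /= minnSS big_ord_recl -IH -phiM -phiD.
Qed.

Lemma phi_herm u v : size u = size v ->
  phi (herm u v) = \sum_(i < size v) phi (nth c0 u i) * phi (nth c0 v i) ^+ 2.
Proof.
move=> suv; rewrite phi_dotc size_map suv minnn; apply: eq_bigr => i _.
by rewrite (nth_map c0) // phiJ.
Qed.

Lemma hermC u v : size u = size v -> herm v u = cconj (herm u v).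
Proof.
rewrite /herm /dotc; elim: u v => [|[a b] u IH] [|[c d] v] //= [suv]; rewrite IH //.
case: (foldr _ _ _) => x y; rewrite /cconj /cadd /cmul /=.
by case: a b c d x y => [] [] [] [] [] [].
Qed.

Definition mxof n (s : seq (seq code)) : 'M[F]_n :=
  \matrix_(i, j) phi (nth c0 (nth [::] s i) j).

Definition sqmx n (s : seq (seq code)) := (size s == n) && all (fun v => size v == n) s.

Lemma sqmx_nth n s i : sqmx n s -> (i < n)%N -> size (nth [::] s i) = n.
Proof. by case/andP=> /eqP <- /all_nthP sn i_n; apply/eqP/sn. Qed.

Lemma mxof_inj n s t : sqmx n s -> sqmx n t -> mxof n s = mxof n t -> s = t.
Proof.
move=> Ss St /matrixP E; have [/andP[/eqP s_n _] /andP[/eqP t_n _]] := (Ss, St).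
apply: (@eq_from_nth _ [::]) => [|i]; rewrite s_n ?t_n // => i_n.
apply: (@eq_from_nth _ c0) => [|j]; rewrite !(sqmx_nth Ss, sqmx_nth St) // => j_n.
by have := E (Ordinal i_n) (Ordinal j_n); rewrite !mxE => /phi_inj.
Qed.

Lemma mxof_surj n (A : 'M[F]_n) : exists2 s, sqmx n s & mxof n s = A.
Proof.
have [g _ gK] := phi_bij; exists [seq [seq g (A i j) | j <- enum 'I_n] | i <- enum 'I_n].
  rewrite /sqmx size_map size_enum_ord eqxx; apply/allP => v /mapP[i _ ->].
  by rewrite size_map size_enum_ord.
apply/matrixP => i j; rewrite mxE (nth_map i) ?size_enum_ord // nth_ord_enum.
by rewrite (nth_map j) ?size_enum_ord // nth_ord_enum gK.
Qed.

Lemma mxofM n s t : sqmx n s -> sqmx n t -> mxof n (mulc n s t) = mxof n s *m mxof n t.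
Proof.
move=> Ss St; apply/matrixP => i j; rewrite !mxE.
have [/andP[/eqP s_n _] /andP[/eqP t_n _]] := (Ss, St).
rewrite (nth_map [::]) ?s_n // (nth_map 0%N) ?size_iota // phi_dotc size_map t_n.
rewrite (sqmx_nth Ss) // minnn; apply: eq_bigr => k _.
by rewrite nth_iota // !mxE (nth_map [::]) ?t_n.
Qed.

Definition unitc n s := sqmx n s && (all (fun v => ceq (herm v v) c1) s && pairwise orthc s).

Definition sigma := pFrobenius_aut charF.

(** [pairwise] checks two rows in one order only; the other order follows from the conjugate
    symmetry [hermC]. *)
Lemma unitcP n s : sqmx n s ->
  unitc n s = (mxof n s *m (map_mx sigma (mxof n s))^T == 1%:M).
Proof.
move=> Ss; have /andP[/eqP s_n /allP sz] := Ss.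
have E i j : (mxof n s *m (map_mx sigma (mxof n s))^T) i j = phi (herm (nth [::] s i) (nth [::] s j)).
  rewrite phi_herm !(sqmx_nth Ss) // mxE; apply: eq_bigr => k _.
  by rewrite !mxE /sigma pFrobenius_autE.
rewrite /unitc Ss /=; apply/andP/eqP => [[/(all_nthP [::]) n1 /(pairwiseP [::]) o]|/matrixP M].
  apply/matrixP => i j; rewrite E mxE.
  have [<-|] := eqVneq i j.
    have: herm (nth [::] s i) (nth [::] s i) == c1 by rewrite -ceqE n1 ?s_n.
    by move/eqP->; rewrite phi1.
  have o' (a b : 'I_n) : (a < b)%N -> herm (nth [::] s b) (nth [::] s a) = c0.
    by move=> ab; apply/eqP; rewrite -ceqE; apply: o; rewrite ?inE ?s_n.
  rewrite -val_eqE neq_ltn => /orP[ij|ji]; last by rewrite o' ?phi0.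
  by rewrite hermC ?o' ?phi0 // !(sqmx_nth Ss).
split.
  apply/(all_nthP [::]) => i; rewrite s_n => i_n; rewrite ceqE; apply/eqP/phi_inj.
  by have := M (Ordinal i_n) (Ordinal i_n); rewrite E mxE eqxx phi1.
apply/(pairwiseP [::]) => i j; rewrite !inE s_n => i_n j_n ij; rewrite /orthc ceqE.
apply/eqP/phi_inj; have := M (Ordinal j_n) (Ordinal i_n); rewrite E mxE -val_eqE /= phi0.
by rewrite gtn_eqF.
Qed.


Definition GU4_set : {set {'GL_4[F]}} :=
  [set A : {'GL_4[F]} | GLval A *m (map_mx sigma (GLval A))^T == 1%:M].

Fact GU4_group_set : group_set GU4_set.
Proof.
apply/group_setP; split=> [|A B]; first by rewrite inE GL_1E map_mx1 trmx1 mulmx1.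
rewrite !inE => /eqP uA /eqP uB; rewrite GL_MxE map_mxM trmx_mul.
by rewrite -mulmxA (mulmxA (GLval B)) uB mul1mx uA.
Qed.
Definition GU4 : {group {'GL_4[F]}} := Group GU4_group_set.

Lemma in_GU4 (A : {'GL_4[F]}) : (A \in GU4) = (GLval A *m (map_mx sigma (GLval A))^T == 1%:M).
Proof. by rewrite inE. Qed.

(** The default 1 concerns singular matrices only; the code of a unitary matrix never meets it. *)
Definition gl (s : seq (seq code)) : {'GL_4[F]} := insubd (1%g : {'GL_4[F]}) (mxof 4 s).

Lemma val_gl s : unitc 4 s -> GLval (gl s) = mxof 4 s.
Proof.
move=> us; have /andP[Ss _] := us; apply: insubdK => /=.
by have := us; rewrite unitcP // => /eqP/mulmx1_unit[].
Qed.

Lemma gl_GU s : unitc 4 s -> gl s \in GU4.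
Proof. by move=> us; have /andP[Ss _] := us; rewrite in_GU4 val_gl // -unitcP. Qed.

Lemma gl_inj s t : unitc 4 s -> unitc 4 t -> gl s = gl t -> s = t.
Proof.
move=> us ut E; have /andP[Ss _] := us; have /andP[St _] := ut.
by apply: (mxof_inj Ss St); rewrite -!val_gl // E.
Qed.

Lemma GU_gl A : A \in GU4 -> exists2 s, unitc 4 s & gl s = A.
Proof.
have [s Ss Es] := mxof_surj (GLval A); rewrite in_GU4 -Es -unitcP // => us.
by exists s => //; apply: val_inj; rewrite /= -Es -val_gl.
Qed.

Lemma unitc_mul s t : unitc 4 s -> unitc 4 t -> unitc 4 (mulc 4 s t) -> (gl s * gl t)%g = gl (mulc 4 s t).
Proof.
move=> us ut ust; apply: val_inj; have /andP[Ss _] := us; have /andP[St _] := ut.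
by rewrite -[LHS]/(GLval _) -[RHS]/(GLval _) GL_MxE !val_gl // mxofM.
Qed.

Definition units4 := [seq v <- vecs 4 | ceq (herm v v) c1].

Lemma mem_units4 v : (v \in units4) = (size v == 4) && ceq (herm v v) c1.
Proof. by rewrite mem_filter mem_vecs andbC. Qed.

Lemma uniq_units4 : uniq units4.
Proof. exact: filter_uniq (uniq_vecs 4). Qed.

Local Opaque units4.

Lemma all2_filter_mem (T : eqType) (a b : pred T) (U : seq T) (Ps : seq (pred T)) s :
    (forall v, (v \in U) = a v && b v) ->
  all2 (fun v V => v \in V) s [seq filter P U | P <- Ps] =
  [&& size s == size Ps, all a s, all b s & all2 (fun v P => P v) s Ps].
Proof.
move=> Uab; elim: s Ps => [|v s IH] [|P Ps] //=.
rewrite IH mem_filter Uab eqSS -!andbA; do !bool_congr.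
Qed.

Lemma mem_frames_units (Ps : seq (pred (seq code))) s : size Ps = 4 ->
  (s \in frames 4 [seq filter P units4 | P <- Ps]) = unitc 4 s && all2 (fun v P => P v) s Ps.
Proof.
move=> sPs; rewrite mem_frames ?size_map // /unitc /sqmx -sPs.
rewrite (all2_filter_mem _ _ mem_units4) sPs -!andbA; do !bool_congr.
Qed.

(** Orders are found by counting: a subset of GU_4(2) cut out by one condition on each row has as
    many elements as there are orthonormal frames satisfying these conditions, a number that can be
    computed. *)
Lemma card_GU_sub (X : {set {'GL_4[F]}}) Ps : size Ps = 4 -> X \subset GU4 ->
    (forall s, unitc 4 s -> (gl s \in X) = all2 (fun v P => P v) s Ps) ->
  #|X| = nframes 4 [seq filter P units4 | P <- Ps].
Proof.
move=> sPs /subsetP sXG XP; rewrite -size_frames -(size_map gl).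
rewrite -(card_uniqP _); last first.
  rewrite map_inj_in_uniq ?uniq_frames //.
    rewrite all_map (@eq_all _ _ predT) ?all_predT // => P.
    exact: filter_uniq uniq_units4.
  by move=> s t; rewrite !mem_frames_units // => /andP[us _] /andP[ut _]; apply: gl_inj.
apply: eq_card => A; apply/idP/mapP => [XA|[s]]; last first.
  by rewrite mem_frames_units // => /andP[us Ps_s] ->; rewrite XP.
have [s us Es] := GU_gl (sXG _ XA); exists s => //.
by rewrite mem_frames_units // us -XP // Es.
Qed.

Lemma card_GU4 : #|GU4| = (2 ^ 6 * 3 ^ 5 * 5)%N.
Proof.
rewrite (@card_GU_sub GU4 (nseq 4 (fun=> true)) erefl (subxx _)).
  by apply/eqP; vm_compute.
move=> s us; rewrite gl_GU //; have /andP[/andP[/eqP s4 _] _] := us.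
by case: s {us} s4 => [|? [|? [|? [|? []]]]].
Qed.

Definition tmx := [:: [:: c1; c0; c0; c0]; [:: c0; c1; c0; c0]; [:: c0; c0; cw; c0]; [:: c0; c0; c0; cv]].

(** A matrix commuting with [tmx] preserves its eigenspaces, which have dimensions 2, 1, 1: it is
    block diagonal, and [P12], [P3], [P4] describe its rows. *)
Definition P12 : pred (seq code) := fun v => ceq (nth c0 v 2) c0 && ceq (nth c0 v 3) c0.
Definition P3 : pred (seq code) :=
  fun v => [&& ceq (nth c0 v 0) c0, ceq (nth c0 v 1) c0 & ceq (nth c0 v 3) c0].
Definition P4 : pred (seq code) :=
  fun v => [&& ceq (nth c0 v 0) c0, ceq (nth c0 v 1) c0 & ceq (nth c0 v 2) c0].

Lemma csimp : (left_id c0 cadd * right_id c0 cadd * left_zero c0 cmul * right_zero c0 cmul *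
  left_id c1 cmul * right_id c1 cmul)%type.
Proof. by do !split; case=> [[] []]. Qed.

(** An entry [x] of a matrix commuting with a diagonal one satisfies [x a = b x] for two diagonal
    entries [a], [b]; it vanishes unless [a = b]. *)
Lemma ceigen : ((forall x, (cmul x cw == x) = (x == c0)) * (forall x, (cmul x cv == x) = (x == c0)) *
  (forall x, (x == cmul cw x) = (x == c0)) * (forall x, (x == cmul cv x) = (x == c0)) *
  (forall x, (cmul x cv == cmul cw x) = (x == c0)) * (forall x, (cmul x cw == cmul cv x) = (x == c0)) *
  (forall x, (cmul x cw == cmul cw x)) * (forall x, (cmul x cv == cmul cv x)))%type.
Proof. by do !split; case=> [[] []]. Qed.

Lemma sqmx_mulc s t : sqmx 4 s -> sqmx 4 (mulc 4 s t).
Proof.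
rewrite /sqmx !size_map => /andP[-> _]; apply/allP => v /mapP[u _ ->].
by rewrite size_map.
Qed.

Lemma comm_gl s t : unitc 4 s -> unitc 4 t ->
  (gl t \in 'C[gl s]%g) = (mulc 4 t s == mulc 4 s t).
Proof.
move=> us ut; have /andP[Ss _] := us; have /andP[St _] := ut.
apply/cent1P/eqP => [E|E].
  apply: (@mxof_inj 4); rewrite ?sqmx_mulc //.
  have := congr1 (fun A : {'GL_4[F]} => GLval A) E.
  by rewrite !GL_MxE !val_gl // -!mxofM.
by apply: val_inj; rewrite -[LHS]/(GLval _) -[RHS]/(GLval _) !GL_MxE !val_gl // -!mxofM // E.
Qed.

(** The centraliser is GU_2(2) x GU_1(2) x GU_1(2), of order 18 times 3 times 3. *)
Lemma card_C_GU_t : #|'C_GU4[gl tmx]%g| = (2 * 3 ^ 4)%N.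
Proof.
have ut : unitc 4 tmx by vm_compute.
rewrite (@card_GU_sub 'C_GU4[gl tmx]%g [:: P12; P12; P3; P4] erefl (subsetIl _ _)).
  by apply/eqP; vm_compute.
move=> s us.
rewrite inE gl_GU //=; have /andP[Ss _] := us; have /andP[St _] := ut.
rewrite comm_gl //.
case: s Ss {us} => [|r1 [|r2 [|r3 [|r4 [|]]]]] //.
case: r1 => [|a1 [|a2 [|a3 [|a4 [|]]]]] //.
case: r2 => [|b1 [|b2 [|b3 [|b4 [|]]]]] //.
case: r3 => [|d1 [|d2 [|d3 [|d4 [|]]]]] //.
case: r4 => [|e1 [|e2 [|e3 [|e4 [|]]]]] // _.
rewrite /mulc /P12 /P3 /P4 /dotc /= !csimp !eqseq_cons !eqxx !ceqE !andbT /=.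
by rewrite !ceigen andbT.
Qed.

Definition SU4 : {group {'GL_4[F]}} := SU_group 4 (pFrobenius_aut charF).

Lemma in_SU4 A : (A \in SU4) = (A \in GU4) && (\det (GLval A) == 1).
Proof. by rewrite !inE. Qed.

Definition diagc (l : seq code) :=
  [seq [seq if i == j then nth c0 l i else c0 | j <- iota 0 4] | i <- iota 0 4].

Lemma mxof_diagc l : mxof 4 (diagc l) = diag_mx (\row_i phi (nth c0 l i)).
Proof.
apply/matrixP => i j; rewrite !mxE (nth_map 0%N) ?size_iota // (nth_map 0%N) ?size_iota //.
rewrite !nth_iota // !add0n -val_eqE /=; case: ifP => _; first by rewrite mulr1n.
by rewrite mulr0n phi0.
Qed.

Lemma det_diagc l : \det (mxof 4 (diagc l)) = \prod_(i < 4) phi (nth c0 l i).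
Proof. by rewrite mxof_diagc det_diag; apply: eq_bigr => i _; rewrite mxE. Qed.

Lemma gl1 : gl (diagc [:: c1; c1; c1; c1]) = 1%g.
Proof.
apply: val_inj; rewrite -[LHS]/(GLval _) val_gl; last by vm_compute.
rewrite mxof_diagc -[RHS]/(1%:M : 'M_4) -diag_const_mx; congr diag_mx.
by apply/rowP => -[[|[|[|[|]]]] //= lt4]; rewrite !mxE phi1.
Qed.

Definition dmx := diagc [:: cw; c1; c1; c1].

Lemma phi_cv : phi cv = omega ^+ 2.
Proof. by rewrite omega2 /phi mul1r addrC. Qed.
Lemma phi_cw : phi cw = omega.
Proof. by rewrite /phi mul1r add0r. Qed.

(** The determinant of [dmx] generates the nonzero elements of F_4, so its powers represent the
    three cosets of SU_4 in GU_4. *)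
Lemma card_SU4 : #|SU4| = (2 ^ 6 * 3 ^ 4 * 5)%N.
Proof.
pose dmx := diagc [:: cw; c1; c1; c1].
have ud : unitc 4 dmx by vm_compute.
have det_d : \det (GLval (gl dmx)) = omega.
  rewrite val_gl // det_diagc !big_ord_recl big_ord0.
  by rewrite !phi1 !mulr1 phi_cw.
suffices: #|GU4| = (#|SU4| * 3)%N.
  rewrite card_GU4 (_ : 2 ^ 6 * 3 ^ 5 * 5 = 2 ^ 6 * 3 ^ 4 * 5 * 3)%N.
    by move/eqP; rewrite eqn_pmul2r // => /eqP.
  by rewrite (expnSr 3) -!mulnA; do 2 congr muln; rewrite mulnC.
have detV A B : GLval (A * B^-1)%g = GLval A *m invmx (GLval B) by rewrite GL_MxE GL_VxE.
apply: (@card_index3 _ _ _ (gl dmx)); last 1 first.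
- move=> A GA; rewrite !in_SU4 !groupM ?groupV ?groupM ?GA ?gl_GU // !andTb.
  rewrite !detV !GL_MxE !det_mulmx !det_inv det_mulmx det_d.
  have [g _ gK] := phi_bij; rewrite -(gK (\det (GLval A))).
  case: (g _) (GL_det A) (gK (\det (GLval A))) => [[] []] det0 detg.
  - by rewrite phi_cv expr2 mulfV ?eqxx ?orbT // mulf_neq0 ?omega_neq0.
  - by rewrite phi1 eqxx.
  - by rewrite phi_cw mulfV ?eqxx ?orbT ?omega_neq0.
  - by case/eqP: det0; rewrite -detg -phi0.
- by apply/subsetP => A; rewrite in_SU4 => /andP[].
- exact: gl_GU.
- by rewrite in_SU4 det_d (negPf omega_neq1) andbF.
- by rewrite !unitc_mul //; apply: gl1.
Qed.

(** * Elements and centre of SU_4(2) *)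

Definition permc (l : seq nat) :=
  [seq [seq if nth 0%N l i == j then c1 else c0 | j <- iota 0 4] | i <- iota 0 4].

Lemma gl_diag_SU l : unitc 4 (diagc l) -> \prod_(i < 4) phi (nth c0 l i) = 1 -> gl (diagc l) \in SU4.
Proof. by move=> ul l1; rewrite in_SU4 gl_GU // val_gl // det_diagc l1 eqxx. Qed.

(** The determinant squares to 1, hence is 1 or -1, and these agree in characteristic 2. *)
Lemma gl_inv_SU s : unitc 4 s -> mulc 4 s s = diagc [:: c1; c1; c1; c1] -> gl s \in SU4.
Proof.
move=> us ss; rewrite in_SU4 gl_GU //=.
have: (gl s * gl s)%g = 1%g by rewrite unitc_mul ?ss ?gl1.
move/(congr1 (fun A : {'GL_4[F]} => \det (GLval A))); rewrite GL_MxE det_mulmx GL_1E det1.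
rewrite -expr2 => /eqP; rewrite sqrf_eq1 => /orP[//|/eqP->].
by rewrite eq_sym -addr_eq0 addxx.
Qed.

Definition t12 := diagc [:: cw; cv; c1; c1].
Definition t34 := diagc [:: c1; c1; cw; cv].
Definition s12 := permc [:: 1; 0; 2; 3].
Definition s23 := permc [:: 0; 2; 1; 3].
Definition s34 := permc [:: 0; 1; 3; 2].
(** The all-ones matrix minus the identity: an involution in characteristic 2, which commutes with
    every permutation matrix. *)
Definition j4 := [seq [seq if i == j then c0 else c1 | j <- iota 0 4] | i <- iota 0 4].

Lemma SU4_gens : [/\ gl t12 \in SU4, gl t34 \in SU4, gl s12 \in SU4,
  gl s23 \in SU4 & gl s34 \in SU4 /\ gl j4 \in SU4].
Proof.
by split; [apply: gl_diag_SU | apply: gl_diag_SU | | | ];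
   rewrite ?gl_inv_SU //; rewrite !big_ord_recl big_ord0 /= !phi1 !mulr1 ?mul1r;
   rewrite phi_cw phi_cv -exprS omega3.
Qed.

(** Commuting with [t12] and [t34] makes a matrix diagonal, commuting with the three transpositions
    makes it scalar. A scalar [e] has determinant [e^4 = e], which must be 1. *)
Lemma center_SU4 : 'Z(SU4)%g = 1%g.
Proof.
apply/trivgP/subsetP => A /centerP[SA cA]; have [St12 St34 Ss12 Ss23 [Ss34 _]] := SU4_gens.
have := SA; rewrite in_SU4 => /andP[GA /eqP detA].
have [s us Es] := GU_gl GA; rewrite -Es in cA detA *; rewrite val_gl // in detA.
have cs r : gl r \in SU4 -> unitc 4 r -> mulc 4 s r = mulc 4 r s.
  by move=> Sr ur; apply/eqP; rewrite -comm_gl //; apply/cent1P; rewrite /commute cA.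
have := cs _ St12 isT; have := cs _ St34 isT; have := cs _ Ss12 isT.
have := cs _ Ss23 isT; have := cs _ Ss34 isT.
have /andP[Ss _] := us.
case: s Ss {us cs Es cA} detA => [|r1 [|r2 [|r3 [|r4 [|]]]]] //.
case: r1 => [|a1 [|a2 [|a3 [|a4 [|]]]]] //.
case: r2 => [|b1 [|b2 [|b3 [|b4 [|]]]]] //.
case: r3 => [|d1 [|d2 [|d3 [|d4 [|]]]]] //.
case: r4 => [|e1 [|e2 [|e3 [|e4 [|]]]]] // _ detA.
rewrite /mulc /dotc /= !csimp => E34 E23 E12.
have /= {E34} E34 := congr1 (fun s => nth c0 (nth [::] s 2) 3) E34.
have /= {E23} E23 := congr1 (fun s => nth c0 (nth [::] s 1) 2) E23.
have /= {E12} E12 := congr1 (fun s => nth c0 (nth [::] s 0) 1) E12.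
subst a1 b2 d3.
move/eqP; rewrite !eqseq_cons !eqxx !ceigen !andbT /= => Et34.
move/eqP; rewrite !eqseq_cons !eqxx !ceigen !andbT /= => Et12.
repeat match goal with H: is_true (_ && _) |- _ => case/andP: H => ? ? end.
repeat match goal with H: is_true (_ == _) |- _ => move/eqP: H => ?; subst end.
have e1: phi e4 = phi c1.
  have := det_diagc [:: e4; e4; e4; e4]; rewrite /diagc /= detA !big_ord_recl big_ord0 /=.
  have := expf_card (phi e4); rewrite cardF !exprS expr0 !mulr1 phi1 => ->.
  by move->.
by rewrite (phi_inj e1) inE -gl1 /diagc /=.
Qed.

(** Here [a], [b], [c] generate a subgroup 2^3, [t] and [u] a subgroup 3^2, and [a t] has order 6.
    The relations are checked by multiplying codes. *)
Lemma SU4_relations : exists a b c t u : {'GL_4[F]},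
  [/\ [/\ a \in SU4, b \in SU4, c \in SU4, t \in SU4 & u \in SU4],
      [/\ a * a = 1, b * b = 1, c * c = 1, t * t * t = 1 & u * u * u = 1]%g,
      [/\ a * b = b * a, a * c = c * a, b * c = c * b, t * u = u * t & a * t = t * a]%g,
      [/\ a != 1, b != 1, b != a & t != 1]%g &
      [/\ [/\ c != 1, c != a, c != b & c != a * b]%g,
          [/\ u != 1, u != t & u != t * t]%g & logn 2 #|'C_SU4[t]%g| = 1%N]].
Proof.
have [St12 St34 Ss12 Ss23 [Ss34 Sj]] := SU4_gens.
exists (gl s12), (gl s34), (gl j4), (gl t34), (gl t12).
have glM s t : unitc 4 s -> unitc 4 t -> unitc 4 (mulc 4 s t) -> (gl s * gl t)%g = gl (mulc 4 s t).
  exact: unitc_mul.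
have glN s t : unitc 4 s -> unitc 4 t -> s != t -> gl s != gl t.
  by move=> us ut; apply: contraNneq => /gl_inj->.
have at34 : (gl s12 * gl t34 = gl t34 * gl s12)%g by rewrite !glM.
split=> //; rewrite -?gl1.
- by rewrite !glM.
- by split; rewrite ?at34 // !glM.
- by rewrite !glN.
split; [by rewrite !glM // !glN | by rewrite !glM // !glN | ].
(* The centraliser of [t] in GU_4 has order [2 * 3^4], and the involution [s12] lies in the one in
   SU_4; so the 2-part of the latter is exactly 2. *)
have cardC : (#|'C_SU4[gl t34]%g| %| 2 * 3 ^ 4)%N.
  rewrite -card_C_GU_t cardSg // setSI //; apply/subsetP => A.
  by rewrite in_SU4 => /andP[].
have even_C : (2 %| #|'C_SU4[gl t34]%g|)%N.
  have o_a : #[gl s12]%g = 2%N.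
    by apply: nt_prime_order => //; rewrite -?gl1 ?glN // expgS expg1 glM.
  have: gl s12 \in 'C_SU4[gl t34]%g by rewrite inE Ss12; apply/cent1P.
  by move/order_dvdG; rewrite o_a.
apply/eqP; rewrite eqn_leq -(@pfactor_dvdn 2 1) // even_C andbT.
apply: leq_trans (dvdn_leq_log 2 _ cardC) _ => //.
Qed.

End OrderFour.

Lemma SU4_isog_U42 : SU4 pchar_F4 \isog U42.
Proof.
apply: quotient_isog; first exact: gFnorm.
have /= -> := center_SU4 pchar_F4 card_F4; exact: (setI1g (SU4 pchar_F4)).
Qed.

Lemma abelem_cycle_extend (gT : finGroupType) p (E : {group gT}) x :
    prime p -> p.-abelem E -> x \in 'C(E) -> x ^+ p = 1 -> x \notin E ->
  p.-abelem (E <*> <[x]>) /\ #|E <*> <[x]>| = (#|E| * p)%N.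
Proof.
move=> p_pr abE cEx xp1 E'x; have x1: x != 1 by apply: contraNneq E'x => ->.
have ox : #[x] = p by apply: nt_prime_order.
have tiEx : E :&: <[x]> = 1 by rewrite setIC prime_TIg -?orderE ?ox // cycle_subG.
have cEx' : <[x]> \subset 'C(E) by rewrite cycle_subG.
have dE : E \x <[x]> = E <*> <[x]> by rewrite dprodEY.
split; last by rewrite -(dprod_card dE) -orderE ox.
rewrite (dprod_abelem _ dE) abE; apply/abelemP => //; split; first exact: cycle_abelian.
by move=> y /cycleP[k ->]; rewrite -expgM mulnC expgM xp1 expg1n.
Qed.

Lemma cycle2 (gT : finGroupType) (x : gT) : x * x = 1 -> <[x]> =i pred2 1 x.
Proof.
move=> x2 y; apply/cycleP/pred2P => [[k ->]|[]->]; [|by exists 0|by exists 1%N; rewrite expg1].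
elim: k => [|k [] IH]; first by left.
  by right; rewrite expgS IH mulg1.
by left; rewrite expgS IH.
Qed.

(** All that the sequel uses about the structure of U_4(2), in a form invariant under
    isomorphism. *)
Definition U42_shape (gT : finGroupType) (H : {group gT}) : Prop :=
  [/\ #|H| = (2 ^ 6 * 3 ^ 4 * 5)%N,
      exists2 E : {group gT}, E \subset H & 2.-abelem E /\ #|E| = 8,
      exists2 E : {group gT}, E \subset H & 3.-abelem E /\ #|E| = 9,
      exists2 x, x \in H & #[x] = 6
    & exists2 t, t \in H & #[t] = 3 /\ logn 2 #|'C_H[t]| = 1%N].

Lemma U42_shape_relations (gT : finGroupType) (H : {group gT}) (a b c t u : gT) :
   #|H| = (2 ^ 6 * 3 ^ 4 * 5)%N ->
   [/\ a \in H, b \in H, c \in H, t \in H & u \in H] ->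
   [/\ a * a = 1, b * b = 1, c * c = 1, t * t * t = 1 & u * u * u = 1]%g ->
   [/\ a * b = b * a, a * c = c * a, b * c = c * b, t * u = u * t & a * t = t * a]%g ->
   [/\ a != 1, b != 1, b != a & t != 1]%g ->
   [/\ c != 1, c != a, c != b & c != a * b]%g ->
   [/\ u != 1, u != t & u != t * t]%g -> logn 2 #|'C_H[t]%g| = 1%N ->
  U42_shape H.
Proof.
move=> oH [Ha Hb Hc Ht Hu] [a2 b2 c2 t3 u3] [ab ac bc tu at_] [a1 b1 ba t1].
move=> [nc1 ca cb cab] [u1 ut utt] oC.
have sq (x : gT) : x * x = 1 -> x ^+ 2 = 1 by rewrite expgS expg1.
have cb3 (x : gT) : x * x * x = 1 -> x ^+ 3 = 1 by rewrite !expgS expg0 mulg1 mulgA.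
have oa : #[a] = 2 by apply: nt_prime_order => //; apply: sq.
have ot : #[t] = 3 by apply: nt_prime_order => //; apply: cb3.
split=> //; last 1 first.
- by exists t.
- have abA : 2.-abelem <[a]>.
    by rewrite prime_abelem // -orderE oa.
  have cab' : b \in 'C(<[a]>) by rewrite cent_cycle; apply/cent1P; rewrite /commute ab.
  have nab : b \notin <[a]> by rewrite cycle2 // inE negb_or b1.
  have [abB oB] := @abelem_cycle_extend _ 2 _ _ isT abA cab' (sq _ b2) nab.
  have cB : c \in 'C(<[a]> <*> <[b]>).
    rewrite centY inE !cent_cycle; apply/andP; split; apply/cent1P; rewrite /commute ?ac ?bc //.
  have nc : c \notin <[a]> <*> <[b]>.
    rewrite /= joingE /= -/(_ <*> _) norm_joinEr; last by rewrite cents_norm // cycle_subG.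
    apply/mulsgP => -[x y]; rewrite cycle2 // cycle2 // => /pred2P[]-> /pred2P[]-> Ec.
    - by rewrite Ec mulg1 eqxx in nc1.
    - by rewrite Ec mul1g eqxx in cb.
    - by rewrite Ec mulg1 eqxx in ca.
    - by rewrite Ec eqxx in cab.
  have [abC oCC] := @abelem_cycle_extend _ 2 _ _ isT abB cB (sq _ c2) nc.
  exists (<[a]> <*> <[b]> <*> <[c]>)%G; first by rewrite !join_subG !cycle_subG Ha Hb.
  by split=> //; rewrite oCC oB -orderE oa.
- have abT : 3.-abelem <[t]> by rewrite prime_abelem // -orderE ot.
  have ctu : u \in 'C(<[t]>) by rewrite cent_cycle; apply/cent1P; rewrite /commute tu.
  have ntu : u \notin <[t]>.
    apply/negP => /cyclePmin[k]; rewrite ot; case: k => [|[|[|k]]] // _ Eu.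
    - by rewrite Eu expg0 eqxx in u1.
    - by rewrite Eu expg1 eqxx in ut.
    - by rewrite Eu expgS expg1 eqxx in utt.
  have [abU oU] := @abelem_cycle_extend _ 3 _ _ isT abT ctu (cb3 _ u3) ntu.
  exists (<[t]> <*> <[u]>)%G; first by rewrite !join_subG !cycle_subG Ht Hu.
  by split=> //; rewrite oU -orderE ot.
- exists (a * t); first exact: groupM.
  by rewrite orderM ?oa ?ot //.
Qed.

Lemma U42_shape_isog (aT rT : finGroupType) (G : {group aT}) (H : {group rT}) :
  G \isog H -> U42_shape G -> U42_shape H.
Proof.
move=> isoGH [oG [E sEG [abE oE]] [E' sEG' [abE' oE']] [x Gx ox] [t Gt [ot oC]]].
have [f injf fH] := isogP isoGH; have {fH isoGH} <- : (f @* G)%G = H by apply: val_inj.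
split; first by rewrite card_injm.
- by exists (f @* E)%G; [apply: morphimS | rewrite /= injm_abelem // card_injm].
- by exists (f @* E')%G; [apply: morphimS | rewrite /= injm_abelem // card_injm].
- by exists (f x); [apply: mem_morphim | rewrite order_injm].
- exists (f t); first exact: mem_morphim.
  by rewrite order_injm // -injm_subcent1 // card_injm ?subsetIl.
Qed.

Lemma U42_shapeP (gT : finGroupType) (H : {group gT}) : H \isog U42 -> U42_shape H.
Proof.
move=> isoH; apply: U42_shape_isog (isog_trans SU4_isog_U42 (isog_symr isoH)) _.
have [a [b [c [t [u [S1 S2 S3 S4 [S5 S6 S7]]]]]]] := SU4_relations pchar_F4 card_F4.
exact: U42_shape_relations (card_SU4 pchar_F4 card_F4) S1 S2 S3 S4 S5 S6 S7.
Qed.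

(** * Groups without elements of order pq *)

Section FixedPoints.

Variable gT : finGroupType.
Implicit Types (G A E L N P Q R S : {group gT}) (p q r s : nat).

Import FiniteModule.

Lemma actr_sum_orbit N (abN : abelian N) (B : {group gT}) (v : fmod_of abN) x :
  B \subset 'N(N) -> x \in B -> ((\sum_(b in B) v ^@ b) ^@ x = \sum_(b in B) v ^@ b)%R.
Proof.
move=> nNB Bx; rewrite actr_sum [RHS](reindex_inj (mulIg x)) /=.
by apply: eq_big => [b|b Bb]; rewrite ?groupMr // -actrM ?(subsetP nNB).
Qed.

(** The sum is fixed by [B], so it lies in ['C_N(B)]. *)
Lemma fmod_sum_fixed N (abN : abelian N) (B : {group gT}) (v : fmod_of abN) :
  B \subset 'N(N) -> 'C_N(B) = 1 -> (\sum_(b in B) v ^@ b = 0)%R.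
Proof.
move=> nNB cNB; set w := (\sum_(b in B) _)%R; apply: val_inj.
apply/eqP; rewrite fmval0 -in_set1 -[[set 1]]/(1%g : {set gT}) -cNB inE fmodP.
apply/centP => x Bx; apply/commgP/conjg_fixP.
by rewrite -fmvalJ ?(subsetP nNB) // actr_sum_orbit.
Qed.

Lemma expgM_coset A y a k : y \in 'N(A) -> a \in A -> y ^- k * (y * a) ^+ k \in A.
Proof.
move=> nAy Aa; elim: k => [|k IH]; first by rewrite !expg0 mulg1 invg1 group1.
have -> : y ^- k.+1 * (y * a) ^+ k.+1 = (y ^- k * (y * a) ^+ k) ^ y * a.
  by rewrite conjgE !expgSr invMg !mulgA.
by rewrite groupM // memJ_norm.
Qed.

(* Sum v^g over the cyclic groups <y a>: they cover y^j A exactly once for each j prime to l. *)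
Lemma fixed_point_free_cover N A y l :
    abelian N -> prime l -> A \subset 'N(N) -> y \in 'N(N) -> y \in 'N(A) ->
    {in A, forall a, (y * a) ^+ l = 1} -> 'C_N(A) = 1 ->
    {in A, forall a, 'C_N[y * a] = 1} -> coprime #|N| #|A| -> N :=: 1.
Proof.
move=> abN l_pr nNA nNy nAy yA_l cNA cNy coNA; apply/trivgP/subsetP => n Nn.
pose v := fmod abN n.
have nNyA a : a \in A -> y * a \in 'N(N) by move=> Aa; rewrite groupM // (subsetP nNA).
have fixed0 (w : fmod_of abN) x : x \in 'N(N) -> 'C_N[x] = 1 -> (w ^@ x = w)%R -> w = 0%R.
  move=> nNx cNx wx; apply: val_inj; apply/set1P.
  have: val w \in 'C_N[x].
    by rewrite inE fmodP; apply/cent1P/commgP/conjg_fixP; rewrite -fmvalJ // wx.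
  by rewrite cNx.
(* The sum over the powers of [y a] is fixed by [y a], hence vanishes. *)
have inner a : a \in A -> (\sum_(j < l) v ^@ ((y * a) ^+ j) = 0)%R.
  move=> Aa; apply: (fixed0 _ (y * a)); rewrite ?nNyA ?cNy // actr_sum.
  rewrite -(prednK (prime_gt0 l_pr)) big_ord_recr big_ord_recl /= addrC; congr (_ + _)%R.
    rewrite -actrM ?groupX ?nNyA // -expgSr prednK ?prime_gt0 // yA_l // expg0 //.
  by apply: eq_bigr => i _; rewrite -actrM ?groupX ?nNyA // -expgSr.
have swap : (\sum_(j < l) \sum_(a in A) v ^@ ((y * a) ^+ j) = 0)%R.
  by rewrite exchange_big big1.
have l_gt0 := prime_gt0 l_pr.
(* For [j] nonzero the map from [a] to [y^-j (y a)^j] permutes [A]: as [j] is prime to [l], some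
   power of [(y a)^j] is [y a] again. The sum is thus a sum over [A] applied to one vector, and
   vanishes. *)
have other (j : 'I_l) : j != Ordinal l_gt0 -> (\sum_(a in A) v ^@ ((y * a) ^+ j) = 0)%R.
  move=> nt_j; pose h a := y ^- j * (y * a) ^+ j.
  have hA a : a \in A -> h a \in A.
    by move=> Aa; apply: expgM_coset.
  have h_inj : {in A &, injective h}.
    move=> a b Aa Ab /mulgI eq_ab; apply: (mulgI y).
    have co_jl : coprime j l.
      rewrite coprime_sym prime_coprime // gtnNdvd // lt0n.
      by apply: contraNneq nt_j => j0; apply/eqP/val_inj.
    have j_gt0 : 0 < j by rewrite lt0n; apply: contraNneq nt_j => j0; apply/eqP/val_inj.
    have [km kn E _] := egcdnP l j_gt0; rewrite (eqP co_jl) in E.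
    have expK c : c \in A -> (y * c) ^+ j ^+ km = y * c.
      by move=> Ac; rewrite -expgM mulnC E expgD expg1 mulnC expgM yA_l // expg1n mul1g.
    by rewrite -(expK a Aa) -(expK b Ab) eq_ab.
  have im_h : h @: A = A.
    apply/eqP; rewrite eqEcard (card_in_imset h_inj) leqnn andbT.
    by apply/subsetP => _ /imsetP[a Aa ->]; apply: hA.
  transitivity (\sum_(b in h @: A) actr (actr v (y ^+ j)) b)%R.
    rewrite big_imset //=; apply: eq_bigr => a Aa.
    have nNh : h a \in 'N(N) := subsetP nNA _ (hA a Aa).
    by rewrite -actrM ?groupX // /h mulgA mulgV mul1g.
  by rewrite im_h fmod_sum_fixed.
(* Only the terms with [j = 0] remain, and they add up to [#|A|] times [v]. *)
rewrite (bigD1 (Ordinal l_gt0)) //= [X in (_ + X)%R]big1 // addr0 in swap.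
have: (v *+ #|A| = 0)%R.
  by rewrite -[RHS]swap -sumr_const; apply: eq_bigr => a _; rewrite expg0 actr1.
move/(congr1 val); rewrite fmvalZ fmodK // fmval0 => nA1.
by rewrite inE -(expgK coNA Nn) nA1 expg1n.
Qed.

Definition no_order (G : {group gT}) n := {in G, forall x, #[x] != n}.

Lemma no_order_commute G p q x y : prime p -> prime q -> p != q -> no_order G (p * q)%N ->
  x \in G -> y \in G -> #[x] = p -> #[y] = q -> ~ commute x y.
Proof.
move=> p_pr q_pr pq nG Gx Gy ox oy cxy; have := nG (x * y) (groupM Gx Gy).
by rewrite orderM ?ox ?oy ?eqxx // prime_coprime // dvdn_prime2.
Qed.

(** A nontrivial fixed point would give an element of order [r] commuting with a power of [y] of
    order [q]. *)
Lemma no_order_cent G R q r y : prime q -> prime r -> q != r -> no_order G (q * r)%N ->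
  R \subset G -> r.-group R -> y \in G -> q.-elt y -> y != 1 -> 'C_R[y] = 1.
Proof.
move=> q_pr r_pr qr nG sRG rR Gy qy nt_y; apply/eqP/negPn/negP => ntC.
have ntY : <[y]> != 1 by rewrite cycle_eq1.
have [_ dvq _] := pgroup_pdiv qy ntY.
have [_ dvr _] := pgroup_pdiv (pgroupS (subsetIl _ _) rR) ntC.
have [u Yu ou] := Cauchy q_pr dvq; have [v Cv ov] := Cauchy r_pr dvr.
have [Rv cvy] := setIP Cv.
have Gu : u \in G by apply: (subsetP _ u Yu); rewrite cycle_subG.
apply: (no_order_commute q_pr r_pr qr nG Gu (subsetP sRG v Rv) ou ov).
by apply/cent1P; apply: (subsetP _ u Yu); rewrite cycle_subG cent1C.
Qed.

(** Otherwise all nontrivial elements of [E] act without fixed points on ['Z(S)], which is not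
    trivial. The covering argument applies to a subgroup of order [r] of [E] and an element [y] of
    [E] outside it. *)
Lemma no_abelem_sq_action G E S r s : prime r -> prime s -> r != s -> no_order G (r * s)%N ->
  E \subset G -> S \subset G -> r.-abelem E -> #|E| = (r ^ 2)%N -> s.-group S -> E \subset 'N(S) ->
  S :=: 1.
Proof.
move=> r_pr s_pr rs nG sEG sSG abE oE sS nSE; apply/eqP/negPn/negP => ntS.
have rE := abelem_pgroup abE.
have ntE : E :!=: 1 by rewrite -cardG_gt1 oE (ltn_exp2l 0) // prime_gt1.
have [_ dvr _] := pgroup_pdiv rE ntE; have [z Ez oz] := Cauchy r_pr dvr.
have [y Ey nzy] : exists2 y, y \in E & y \notin <[z]>.
  apply/subsetPn; apply/negP => /subset_leq_card; rewrite oE -orderE oz leqNgt.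
  by rewrite -{1}[r]expn1 ltn_exp2l // prime_gt1.
have sZE : <[z]> \subset E by rewrite cycle_subG.
have cEE := abelem_abelian abE.
have ntZS : 'Z(S) != 1 by rewrite (center_nil_eq1 (pgroup_nil sS)).
case/eqP: ntZS; have nZS : E \subset 'N('Z(S)) by apply: gFnorm_trans.
have cent1Z x : x \in E -> x != 1 -> 'C_('Z(S))[x] = 1.
  move=> Ex nt_x; apply/trivgP.
  rewrite -(no_order_cent r_pr s_pr rs nG sSG sS (subsetP sEG x Ex) (mem_p_elt rE Ex) nt_x).
  by rewrite setSI // center_sub.
apply: (@fixed_point_free_cover [group of 'Z(S)] [group of <[z]>] y r) => //=.
- exact: center_abelian.
- by rewrite (subset_trans sZE).
- exact: subsetP Ey.
- by apply: (subsetP (sub_abelian_norm cEE sZE)).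
- move=> a Za; have Eya : y * a \in E by rewrite groupM // (subsetP sZE).
  by have [_ ->] := abelemP r_pr abE.
- rewrite cent_cycle cent1Z // -order_gt1 oz prime_gt1 //.
- move=> a Za; apply: cent1Z; first by rewrite groupM // (subsetP sZE).
  by apply: contraNneq nzy => ya1; rewrite -(mulgK a y) ya1 mul1g groupV.
- rewrite -orderE oz; apply: pnat_coprime (pgroupS (center_sub S) sS) _.
  by rewrite pnatE. 
Qed.

(** Let [z] be a central element of order [r]. An element of order [r] outside [<[z]>] would
    generate together with [z] an elementary abelian group of order [r^2]. *)
Lemma rank1_Ohm1 R r : prime r -> r.-group R -> R :!=: 1 ->
    (forall E, E \subset R -> r.-abelem E -> #|E| != (r ^ 2)%N) -> #|'Ohm_1(R)| = r.
Proof.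
move=> r_pr rR ntR noE; have ntZ : 'Z(R) != 1 by rewrite (center_nil_eq1 (pgroup_nil rR)).
have [_ dvr _] := pgroup_pdiv (pgroupS (center_sub R) rR) ntZ.
have [z Zz oz] := Cauchy r_pr dvr; have [Rz cRz] := setIP Zz.
suffices -> : 'Ohm_1(R) = <[z]> by rewrite -orderE.
apply/eqP; rewrite (OhmE 1 rR) expn1 eqEsubset gen_subG cycle_subG; apply/andP; split; last first.
  by apply: mem_gen; rewrite !inE Rz -order_dvdn oz dvdnn.
apply/subsetP => x /LdivP[Rx xr]; apply: contraT => nzx.
have abz : r.-abelem <[z]> by rewrite prime_abelem // -orderE oz.
have czx : x \in 'C(<[z]>) by rewrite cent_cycle cent1C; apply/cent1P/(centP cRz).
have [abE oE] := abelem_cycle_extend r_pr abz czx xr nzx.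
have sER : <[z]> <*> <[x]> \subset R by rewrite join_subG !cycle_subG Rz.
by have := noE (<[z]> <*> <[x]>)%G sER abE; rewrite /= oE -orderE oz mulnn eqxx.
Qed.

Lemma acting_Ohm1 G R S r s : prime r -> prime s -> r != s -> no_order G (r * s)%N ->
  R \subset G -> S \subset G -> r.-group R -> R :!=: 1 -> s.-group S -> S :!=: 1 ->
  R \subset 'N(S) -> #|'Ohm_1(R)| = r.
Proof.
move=> r_pr s_pr rs nG sRG sSG rR ntR sS ntS nSR; apply: rank1_Ohm1 => // E sER abE.
apply: contraNneq ntS => oE; apply/eqP.
exact: (no_abelem_sq_action r_pr s_pr rs nG (subset_trans sER sRG) sSG abE oE sS (subset_trans sER nSR)).
Qed.

(* An automorphism group of Z = Ohm_1(R) is abelian, so [x, Q] centralises Z. *)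
Lemma no_chain4 G Q R S x p q r s :
  prime p -> prime q -> prime r -> prime s -> p != q -> q != r -> r != s ->
  no_order G (p * q)%N -> no_order G (q * r)%N -> no_order G (r * s)%N ->
  [/\ Q \subset G, R \subset G, S \subset G & x \in G] ->
  [/\ q.-group Q, r.-group R, s.-group S & #[x] = p] ->
  [/\ Q :!=: 1, R :!=: 1 & S :!=: 1] ->
  [/\ R \subset 'N(S), Q \subset 'N(R), x \in 'N(R) & x \in 'N(Q)] -> False.
Proof.
move=> p_pr q_pr r_pr s_pr pq qr rs npq nqr nrs [sQG sRG sSG Gx] [qQ rR sS ox] [ntQ ntR ntS].
move=> [nSR nRQ nRx nQx].
have oZ := acting_Ohm1 r_pr s_pr rs nrs sRG sSG rR ntR sS ntS nSR.
have cZ : cyclic 'Ohm_1(R) by rewrite prime_cyclic ?oZ.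
have /cyclicP[z defZ] := cZ.
have sZR : 'Ohm_1(R) \subset R := Ohm_sub 1 R.
have nZ y : y \in 'N(R) -> y \in 'N('Ohm_1(R)).
  by move=> nRy; apply: (subsetP (gFnorms _ R)).
have Qx g : g \in Q -> [~ x, g] = 1.
  move=> Qg; apply: contraTeq isT => ntc.
  have Qc : [~ x, g] \in Q by rewrite commgEr groupM // memJ_norm ?groupV.
  have := no_order_cent q_pr r_pr qr nqr sRG rR (subsetP sQG _ Qc) (mem_p_elt qQ Qc) ntc.
  suffices: z \in 'C_R[[~ x, g]].
    move=> Cz C1; rewrite C1 in Cz; have := prime_gt1 r_pr.
    by rewrite -oZ defZ (set1P Cz) cycle1 cards1.
  have Zz : z \in 'Ohm_1(R) by rewrite defZ cycle_id.
  rewrite inE (subsetP sZR) //=.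
  have nZx := nZ x nRx; have nZg := nZ g (subsetP nRQ g Qg).
  have [i zx] : exists i, z ^ x = z ^+ i.
    by apply/cycleP; rewrite -defZ memJ_norm.
  have [j zg] : exists j, z ^ g = z ^+ j.
    by apply/cycleP; rewrite -defZ memJ_norm.
  have E : z ^ (g * x) = z ^ (x * g).
    by rewrite !conjgM zx zg !conjXg zx zg -!expgM mulnC.
  (* With this [u], [z ^ [~ x, g] = u ^ (x g) = u ^ (g x) = z], since [x] and [g] act on the cyclic
     group by power maps. *)
  apply/cent1P/commgP/conjg_fixP; set u := z ^ (g * x)^-1.
  have /cycleP[k uk] : u \in <[z]>.
    by rewrite -defZ memJ_norm // groupV groupM.
  have -> : [~ x, g] = (g * x)^-1 * (x * g) by rewrite commgEl conjgE invMg !mulgA.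
  by rewrite conjgM -/u uk conjXg -E -conjXg -uk /u -conjgM mulVg conjg1.
have [_ dvq _] := pgroup_pdiv qQ ntQ.
have [g Qg og] := Cauchy q_pr dvq.
case: (no_order_commute p_pr q_pr pq npq Gx (subsetP sQG g Qg) ox og).
by apply/commgP; rewrite Qx.
Qed.

(* Z<x> with Z = Ohm_1(Q) is a Frobenius group of order p q acting on R without fixed points. *)
Lemma no_triangle3 G Q R x p q r :
  prime p -> prime q -> prime r -> p != q -> q != r -> p != r ->
  no_order G (p * q)%N -> no_order G (q * r)%N -> no_order G (p * r)%N ->
  [/\ Q \subset G, R \subset G & x \in G] ->
  [/\ q.-group Q, r.-group R & #[x] = p] ->
  Q :!=: 1 -> R :!=: 1 ->
  [/\ Q \subset 'N(R), x \in 'N(R) & x \in 'N(Q)] -> False.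
Proof.
move=> p_pr q_pr r_pr pq qr pr npq nqr npr [sQG sRG Gx] [qQ rR ox] ntQ ntR [nRQ nRx nQx].
have oZ := acting_Ohm1 q_pr r_pr qr nqr sQG sRG qQ ntQ rR ntR nRQ.
have sZQ : 'Ohm_1(Q) \subset Q := Ohm_sub 1 Q.
have nZx : x \in 'N('Ohm_1(Q)) by apply: (subsetP (gFnorms _ Q)).
have qZ : q.-group 'Ohm_1(Q) := pgroupS sZQ qQ.
have ntZ : 'Ohm_1(Q) != 1 by rewrite -cardG_gt1 oZ prime_gt1.
have sZG : 'Ohm_1(Q) \subset G := subset_trans sZQ sQG.
have nZR : 'Ohm_1(Q) \subset 'N(R) := subset_trans sZQ nRQ.
(* The power [(x a)^p] lies in ['Ohm_1(Q)], so its order is 1 or [q]. In the second case [x a] has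
   order [q] or [p q]; the first would put [x^q] into ['Ohm_1(Q)], the second is excluded by
   [npq]. *)
have xZ_p a : a \in 'Ohm_1(Q) -> #[x * a] = p.
  move=> Za; have Gxa : x * a \in G by rewrite groupM // (subsetP sZG).
  have Zb : (x * a) ^+ p \in 'Ohm_1(Q).
    by have := expgM_coset p nZx Za; rewrite -{1}ox expg_order invg1 mul1g.
  have nq : (x * a) ^+ q != 1.
    apply/eqP => xaq; have := expgM_coset q nZx Za; rewrite xaq mulg1 groupV => Zxq.
    have: x ^+ q ^+ q = 1 by apply/eqP; rewrite -order_dvdn -[q in (_ %| q)%N]oZ order_dvdG.
    rewrite -expgM => /eqP; rewrite -order_dvdn ox Euclid_dvdM // orbb dvdn_prime2 //.
    by rewrite (negPf pq).
  have [b1|ntb] := eqVneq ((x * a) ^+ p) 1.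
    by apply: nt_prime_order => //; apply: contraNneq nq => ->; rewrite expg1n.
  have ob : #[(x * a) ^+ p] = q.
    by apply: nt_prime_order => //; apply/eqP; rewrite -order_dvdn -[q in (_ %| q)%N]oZ order_dvdG.
  have o_xa : #[x * a] = (q * gcdn #[x * a] p)%N by rewrite -ob orderXgcd divnK ?dvdn_gcdl.
  have [_ /(_ _ (dvdn_gcdr #[x * a] p)) /pred2P[g1|gp]] := primeP p_pr.
    by rewrite g1 muln1 in o_xa; rewrite -o_xa expg_order eqxx in nq.
  by have := npq _ Gxa; rewrite o_xa gp mulnC eqxx.
have ntZR : 'Z(R) != 1 by rewrite (center_nil_eq1 (pgroup_nil rR)).
have cent1Z l y : prime l -> l != r -> no_order G (l * r)%N -> y \in G -> #[y] = l -> 'C_('Z(R))[y] = 1.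
  move=> l_pr lr nlr Gy oy; apply/trivgP.
  have ly : l.-elt y by rewrite /p_elt oy pnat_id.
  have nty : y != 1 by rewrite -order_gt1 oy prime_gt1.
  by rewrite -(no_order_cent l_pr r_pr lr nlr sRG rR Gy ly nty) setSI // center_sub.
case/eqP: ntZR.
have nZZR y : y \in 'N(R) -> y \in 'N('Z(R)) by move=> nRy; apply: (subsetP (gFnorms _ R)).
apply: (@fixed_point_free_cover [group of 'Z(R)] [group of 'Ohm_1(Q)] x p) => //=.
- exact: center_abelian.
- by apply/subsetP => y Zy; apply/nZZR/(subsetP nZR).
- exact: nZZR.
- by move=> a Za; rewrite -(xZ_p a Za) expg_order.
- have [y Zy ntys] := trivgPn _ ntZ; apply/trivgP.
  rewrite -(cent1Z q y q_pr qr nqr (subsetP sZG y Zy)); last first.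
    by apply: nt_prime_order => //; apply/eqP; rewrite -order_dvdn -oZ order_dvdG.
  by rewrite setIS // -cent_set1 centS // sub1set.
- by move=> a Za; apply: (cent1Z p) => //; [rewrite groupM // (subsetP sZG) | apply: xZ_p].
- rewrite oZ; apply: pnat_coprime (pgroupS (center_sub R) rR) _.
  by rewrite pnatE.
Qed.

End FixedPoints.

(** * Chief series *)

Section ChiefChain.

Variables (gT : finGroupType) (G : {group gT}) (Pi : pred nat).
Implicit Types (p q r s : nat) (A B L P Q R : {group gT}).

Hypothesis chief_Pi : forall A B, chief_factor G B A ->
  forall p q, prime p -> prime q -> Pi p -> Pi q ->
    p %| #|A : B| -> q %| #|A : B| -> p = q.

(** The default 1 is taken when [A] is trivial, so the chain is stationary from there on and every
    [n] is an admissible index. *)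
Definition next_chief A : {group gT} := odflt 1%G [pick B : {group gT} | maxnormal B A G].

Definition chief_chain n : {group gT} := iter n next_chief G.
Local Notation K := chief_chain.

Lemma next_chief_max A : A <| G -> A :!=: 1 -> maxnormal (next_chief A) A G.
Proof.
move=> nAG ntA; rewrite /next_chief; case: pickP => [B //|noB].
have [|B maxB _] := @maxgroup_exists _ (fun B : {group gT} => (B \proper A) && (G \subset 'N(B))) 1%G.
  by rewrite /= proper1G ntA norms1.
by have := noB B; rewrite /maxnormal maxB.
Qed.

Lemma next_chief_normal A : A <| G -> next_chief A <| G /\ next_chief A \subset A.
Proof.
rewrite /next_chief; case: pickP => [B maxB|_] nAG /=; last by rewrite normal1 sub1G.
have /andP[prBA nBG] := maxgroupp maxB; split; last exact: proper_sub.
by rewrite /normal nBG (subset_trans (proper_sub prBA)) // normal_sub.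
Qed.

Lemma chief_chain_normal n : K n <| G.
Proof. by elim: n => [|n /next_chief_normal[]] //; apply: normal_refl. Qed.

Lemma chief_chain_sub m n : m <= n -> K n \subset K m.
Proof.
elim: n => [|n IH]; first by rewrite leqn0 => /eqP->.
rewrite leq_eqVlt => /predU1P[->//|/IH]; apply: subset_trans.
by have [_] := next_chief_normal (chief_chain_normal n).
Qed.

Lemma chief_chain_end : K #|G| = 1%G.
Proof.
(* Each step lowers the order until the group is trivial; the successor allows for the order 1 of
   the trivial group once the truncated subtraction reaches 0. *)
suffices H n : (#|K n| <= (#|G| - n).+1)%N.
  by apply: val_inj; apply/eqP; rewrite /= trivg_card_le1 (leq_trans (H _)) // subnn.
elim: n => [|n IH]; first by rewrite subn0.
have [K1|ntK] := eqVneq (K n :> {set gT}) 1.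
  apply: leq_trans (subset_leq_card (chief_chain_sub (leqnSn n))) _.
  by rewrite K1 cards1.
have /andP[prK _] := maxgroupp (next_chief_max (chief_chain_normal n) ntK).
have ltK : #|K n.+1| < #|K n| := proper_card prK.
have gt1K : 1 < #|K n| by rewrite cardG_gt1.
by lia.
Qed.

(** Testing [n.+1] returns the index of the factor [K n / K n.+1] that first involves [p]. *)
Definition chief_pos p := find (fun n => p %| #|G : K n.+1|) (iota 0 #|G|).

Lemma dvdn_indexS m n p : m <= n -> p %| #|G : K m| -> p %| #|G : K n|.
Proof.
by move=> mn pm; apply: dvdn_trans pm _; apply/indexgS/chief_chain_sub.
Qed.

Lemma chief_posP p n : prime p -> p %| #|G| -> (p %| #|G : K n|) = (chief_pos p < n).
Proof.
move=> p_pr pG; have hasP : has (fun n => p %| #|G : K n.+1|) (iota 0 #|G|).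
  apply/hasP; exists #|G|.-1; first by rewrite mem_iota add0n ltn_predL cardG_gt0.
  by rewrite prednK // chief_chain_end indexg1.
apply/idP/idP => [pn|lt_pn].
  case: n => [|n] in pn *; first by rewrite indexgg Euclid_dvd1 in pn.
  rewrite ltnS leqNgt; apply/negP => lt_n.
  have := before_find 0%N lt_n.
  rewrite nth_iota ?add0n ?pn // (leq_trans lt_n) //.
  by rewrite -[leqRHS](size_iota 0) find_size.
apply: dvdn_indexS lt_pn _.
have := nth_find 0%N hasP; rewrite nth_iota //.
by rewrite -[ltnRHS](size_iota 0) -has_find.
Qed.

Lemma chief_pos_inj p q : prime p -> prime q -> Pi p -> Pi q -> p %| #|G| -> q %| #|G| ->
  chief_pos p = chief_pos q -> p = q.
Proof.
move=> p_pr q_pr Pp Pq pG qG Epq; set n := chief_pos p in Epq.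
have np : ~~ (p %| #|G : K n|) by rewrite chief_posP // ltnn.
have nq : ~~ (q %| #|G : K n|) by rewrite chief_posP // -Epq ltnn.
have pS : p %| #|G : K n.+1| by rewrite chief_posP.
have qS : q %| #|G : K n.+1| by rewrite chief_posP // -Epq.
have sKK := chief_chain_sub (leqnSn n).
have [K1|ntK] := eqVneq (K n :> {set gT}) 1.
  by case/negP: np; rewrite K1 indexg1.
have chf : chief_factor G (K n.+1) (K n).
  by rewrite /chief_factor chief_chain_normal next_chief_max ?chief_chain_normal.
move: pS qS; rewrite -(Lagrange_index (normal_sub (chief_chain_normal n)) sKK).
rewrite !Euclid_dvdM // (negPf np) (negPf nq) /=.
exact: chief_Pi chf _ _ p_pr q_pr Pp Pq.
Qed.

(* N0 and N stand for two terms of the chain: q divides |G : N0| but not |G : N|. *)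
Lemma Frattini_step (N0 N L : {group gT}) q :
    prime q -> N0 <| G -> N <| G -> N0 \subset N -> L \subset G -> N0 * L = G ->
    q %| #|L| -> ~~ (q %| #|G : N|) ->
  exists P, [/\ P \subset L, q.-group P, P :!=: 1 & N * 'N_L(P) = G].
Proof.
move=> q_pr nN0 nN sN0N sLG N0L qL qN; have [P sylP] := Sylow_exists q (N :&: L).
have sNG := normal_sub nN.
have NL : N * L = G.
  apply/eqP; rewrite eqEsubset mul_subG // -{1}N0L mulSg //.
have nNL : N :&: L <| L by rewrite setIC (normalGI sLG).
exists P; split.
- by rewrite (subset_trans (pHall_sub sylP)) ?subsetIr.
- exact: pHall_pgroup sylP.
(* If [P] were trivial, [q] would not divide [#|N :&: L|], hence would divide the index of [N :&: L]
   in [L], which is that of [N] in [G]. *)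
- apply: contraNneq qN => P1.
  have := card_Hall sylP; rewrite P1 cards1 => /esym/eqP; rewrite p_part_eq1 /=.
  rewrite /pi mem_primes q_pr cardG_gt0 /= => nq.
  have : q %| #|L : N :&: L|.
    by move: qL; rewrite -(Lagrange (subsetIr N L)) Euclid_dvdM // (negPf nq).
  by rewrite setIC indexgI -indexMg NL.
- transitivity (N * ((N :&: L) * 'N_L(P))); first by rewrite mulgA (mulGSid (subsetIl N L)).
  by rewrite (Frattini_arg nNL sylP).
Qed.

(** * Chains and triangles of nonadjacent primes *)

Section Edges.

Definition nonadj p q := [/\ p != q & no_order G (p * q)%N].

Lemma nonadj_neq p q : nonadj p q -> p != q. Proof. by case. Qed.

Definition in_Pi p := [/\ prime p, Pi p & p %| #|G|].

Lemma covered_dvd (N L : {group gT}) q : N <| G -> L \subset G -> N * L = G -> q %| #|G : N| -> q %| #|L|.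
Proof. by move=> nN sLG NL; rewrite -NL indexMg => qi; apply: dvdn_trans qi (dvdn_indexg L N). Qed.

(* One more link below r: L covers G / K (chief_pos r) and normalises the subgroups found so far. *)
Lemma chain_step (n : nat) L q : in_Pi q -> chief_pos q < n -> L \subset G -> K n * L = G ->
  exists Q : {group gT}, [/\ Q \subset L, q.-group Q, Q :!=: 1 & K (chief_pos q) * 'N_L(Q) = G].
Proof.
move=> [q_pr _ qG] lt_qn sLG KL.
apply: (Frattini_step q_pr (chief_chain_normal n) (chief_chain_normal _) _ sLG KL).
- by apply: chief_chain_sub; apply: ltnW.
- by apply: (covered_dvd (chief_chain_normal n) sLG KL); rewrite chief_posP.
- by rewrite chief_posP // ltnn.
Qed.

Lemma chain_top L p n : in_Pi p -> chief_pos p < n -> L \subset G -> K n * L = G ->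
  exists2 x, x \in L & #[x] = p.
Proof.
move=> [p_pr _ pG] lt_pn sLG KL; have [||x Lx ox] := @Cauchy _ p L; [by [] | | by exists x].
by apply: (covered_dvd (chief_chain_normal n) sLG KL); rewrite chief_posP.
Qed.

Lemma chief_pos_lt p : in_Pi p -> chief_pos p < #|G|.
Proof. by move=> [p_pr _ pG]; rewrite -chief_posP // chief_chain_end indexg1. Qed.

Lemma chief_chain_cover : K #|G| * G = G.
Proof. by rewrite chief_chain_end mul1g. Qed.

(** The subgroups are found from the bottom of the series upwards: [S], then [R] normalising [S],
    then [Q] normalising both, and [x] normalising all three. Each normaliser still covers the
    quotient of [G] in which the next prime appears. *)
Lemma no_descending4 p q r s : in_Pi p -> in_Pi q -> in_Pi r -> in_Pi s ->
  chief_pos p < chief_pos q -> chief_pos q < chief_pos r -> chief_pos r < chief_pos s ->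
  nonadj p q -> nonadj q r -> nonadj r s -> False.
Proof.
move=> Pp Pq Pr Ps pq qr rs [npq opq] [nqr oqr] [nrs ors].
have [S [sSG sS ntS covS]] := chain_step Ps (chief_pos_lt Ps) (subxx G) chief_chain_cover.
have sN1 : 'N_G(S) \subset G := subsetIl _ _.
have [R [sRN rR ntR covR]] := chain_step Pr rs sN1 covS.
have sN2 : 'N_('N_G(S))(R) \subset G := subset_trans (subsetIl _ _) sN1.
have [Q [sQN qQ ntQ covQ]] := chain_step Pq qr sN2 covR.
have sN3 : 'N_('N_('N_G(S))(R))(Q) \subset G := subset_trans (subsetIl _ _) sN2.
have [x Nx ox] := chain_top Pp pq sN3 covQ.
have [p_pr _ _] := Pp; have [q_pr _ _] := Pq; have [r_pr _ _] := Pr; have [s_pr _ _] := Ps.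
have [/setIP[Nx' nRx] nQx] := setIP Nx.
apply: (@no_chain4 _ G Q R S x p q r s) => //; split=> //.
- exact: subset_trans sQN sN2.
- exact: subset_trans sRN sN1.
- exact: (subsetP sN3).
- exact: subset_trans sRN (subsetIr _ _).
- exact: subset_trans sQN (subsetIr _ _).
Qed.

Lemma no_triangle_ordered p q r : in_Pi p -> in_Pi q -> in_Pi r ->
  chief_pos p < chief_pos q -> chief_pos q < chief_pos r ->
  nonadj p q -> nonadj q r -> nonadj p r -> False.
Proof.
move=> Pp Pq Pr pq qr [npq opq] [nqr oqr] [npr opr].
have [R [sRG rR ntR covR]] := chain_step Pr (chief_pos_lt Pr) (subxx G) chief_chain_cover.
have sN1 : 'N_G(R) \subset G := subsetIl _ _.
have [Q [sQN qQ ntQ covQ]] := chain_step Pq qr sN1 covR.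
have sN2 : 'N_('N_G(R))(Q) \subset G := subset_trans (subsetIl _ _) sN1.
have [x Nx ox] := chain_top Pp pq sN2 covQ.
have [p_pr _ _] := Pp; have [q_pr _ _] := Pq; have [r_pr _ _] := Pr.
have [/setIP[Gx nRx] nQx] := setIP Nx.
apply: (@no_triangle3 _ G Q R x p q r) => //; split=> //.
- exact: subset_trans sQN sN1.
- exact: subset_trans sQN (subsetIr _ _).
Qed.

Lemma nonadj_sym p q : nonadj p q -> nonadj q p.
Proof. by case=> pq o; split; rewrite 1?eq_sym // mulnC. Qed.

(** The positions are distinct by [chief_pos_inj], so the three primes can be sorted; two of the
    eight cases are cyclic and contradictory. *)
Lemma no_nonadj_triangle p q r : in_Pi p -> in_Pi q -> in_Pi r ->
  nonadj p q -> nonadj q r -> nonadj p r -> False.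
Proof.
have neq a b : in_Pi a -> in_Pi b -> nonadj a b -> chief_pos a < chief_pos b \/ chief_pos b < chief_pos a.
  move=> [a_pr Pa aG] [b_pr Pb bG] [ab _]; apply/orP; rewrite -neq_ltn.
  by apply: contra ab => /eqP/chief_pos_inj-> .
move=> Pp Pq Pr pq qr pr; have [qp rq rp] := And3 (nonadj_sym pq) (nonadj_sym qr) (nonadj_sym pr).
have [h1|h1] := neq _ _ Pp Pq pq; have [h2|h2] := neq _ _ Pq Pr qr; have [h3|h3] := neq _ _ Pp Pr pr.
- exact: (no_triangle_ordered Pp Pq Pr).
- by have := ltn_trans h1 (ltn_trans h2 h3); rewrite ltnn.
- exact: (no_triangle_ordered Pp Pr Pq).
- exact: (no_triangle_ordered Pr Pp Pq).
- exact: (no_triangle_ordered Pq Pp Pr).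
- exact: (no_triangle_ordered Pq Pr Pp).
- by have := ltn_trans h1 (ltn_trans h3 h2); rewrite ltnn.
- exact: (no_triangle_ordered Pr Pq Pp).
Qed.

End Edges.

End ChiefChain.

(** * Composition factors *)

Lemma prime_dvd_exp p b k : prime p -> prime b -> p %| (b ^ k)%N -> p = b.
Proof. by move=> p_pr b_pr; rewrite Euclid_dvdX // dvdn_prime2 // => /andP[/eqP]. Qed.

Section CompositionFactors.

Variables (gT : finGroupType) (G : {group gT}).
Implicit Types (A B M N L P Q R S : {group gT}) (p q r s : nat).

Local Notation compo := [rel x y : {group gT} | maxnormal y x x].

Lemma exists_maxnormal_over A N : N <| A -> N \proper A ->
  exists2 M : {group gT}, maxnormal M A A & N \subset M.
Proof.
move=> nNA prNA.
have [|M maxM sNM] := @maxgroup_exists _ (fun B : {group gT} => (B \proper A) && (A \subset 'N(B))) N.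
  by rewrite prNA normal_norm.
by exists M.
Qed.

Lemma comps_path_to_normal A N : N <| A -> exists2 s, last A s = N & path compo A s.
Proof.
have [n] := ubnP #|A|; elim: n A => // n IH A leAn nNA.
have [prNA|] := boolP (N \proper A); last first.
  rewrite properEneq normal_sub // andbT negbK => /eqP NA.
  by exists [::] => //; apply: val_inj.
have [M maxM sNM] := exists_maxnormal_over nNA prNA.
have ltMA := proper_card (maxnormal_proper maxM).
have [||s lst_s pth_s] := IH M; first exact: leq_trans ltMA _.
  by apply: normalS sNM (maxnormal_sub maxM) nNA.
by exists (M :: s) => //=; rewrite maxM.
Qed.

(** A composition series of [G] can be made to pass through [N] and [M], so [N / M] is one of its
    factors, up to the representative that [mkfactors] lists. *)
Lemma pseudo_factor M N : pseudo_U42_solvable G -> N <| G -> maxnormal M N N ->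
  abelian (N / M) \/ N / M \isog U42.
Proof.
move=> psG nNG maxM; have [s1 lst1 pth1] := comps_path_to_normal nNG.
have [s2 cmp2] := exists_comps M; have [lst2 pth2] := compsP M s2 cmp2.
have cmpG : comps G (s1 ++ M :: s2).
  by apply/compsP; rewrite last_cat lst1 cat_path pth1 lst1 /= maxM.
have sec_in : section_repr (mkSec N M) \in mkfactors G (s1 ++ M :: s2).
  by apply: map_f; rewrite pairmap_cat lst1 mem_cat /= inE eqxx orbT.
have iso := section_reprP (mkSec N M).
have [ab|isoU] := psG _ cmpG _ sec_in; [left | right].
  by rewrite -(isog_abelian iso).
exact: isog_trans (isog_symr iso) isoU.
Qed.

Lemma solvable_pseudo : solvable G -> pseudo_U42_solvable G.
Proof.
move=> solG s cmp f; have [_ pth] := compsP G s cmp => f_in; left.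
elim: s G solG pth f_in {cmp} => [|M s IH] A solA //= /andP[maxM pth].
rewrite inE => /predU1P[->|]; last exact: IH (solvableS (maxnormal_sub maxM) solA) pth.
rewrite (isog_abelian (section_reprP (mkSec A M))) /=.
have simAM : simple (A / M) by rewrite quotient_simple // maxnormal_normal.
exact/cyclic_abelian/prime_cyclic/simple_sol_prime/simAM/quotient_sol.
Qed.

End CompositionFactors.

(** * Primes dividing a chief factor *)

Section PseudoChief.

Variables (gT : finGroupType) (G : {group gT}).
Implicit Types (A B M N L P Q R S : {group gT}) (p q r s : nat).

Lemma pgroup_sub_p'index A M P p : M <| A -> P \subset A -> p.-group P ->
  prime p -> ~~ (p %| #|A / M|) -> P \subset M.
Proof.
move=> nMA sPA pP p_pr pAM; have nMP : P \subset 'N(M) := subset_trans sPA (normal_norm nMA).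
rewrite -quotient_sub1 // subG1 trivg_card1; apply/eqP.
apply: (@pnat_1 p); first exact: quotient_pgroup.
by apply: pnat_dvd (cardSg (quotientS M sPA)) _; rewrite p'natE.
Qed.

(** If [p] does not divide [#|A / M|], a Sylow [p]-subgroup of [A] lies in all conjugates of [M],
    hence in the core of [M] in [G]. By maximality this core is [B]. *)
Lemma chief_factor_prime A B M p : chief_factor G B A -> maxnormal M A A -> B \subset M ->
  prime p -> p %| #|A : B| -> p %| #|A / M|.
Proof.
case/andP=> maxB nAG maxM sBM p_pr pAB; apply: contraLR pAB => pAM.
have nMA := maxnormal_normal maxM; have [/andP[prBA nBG] maxBE] := maxgroupP maxB.
have nGA := normal_norm nAG.
have [P sylP] := Sylow_exists p A; have sPA := pHall_sub sylP.
have sPcore : P \subset gcore M G.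
  apply/bigcapsP => x Gx; rewrite -sub_conjgV.
  apply: (pgroup_sub_p'index nMA _ _ p_pr pAM); rewrite ?pgroupJ ?(pHall_pgroup sylP) //.
  by rewrite sub_conjgV (normP (subsetP nGA x Gx)).
have coreB : gcore M G = B.
  apply: maxBE; last by rewrite sub_gcore.
  by rewrite gcore_norm (sub_proper_trans (gcore_sub M G)) // (maxnormal_proper maxM).
rewrite coreB in sPcore.
rewrite -p'natE //; apply: pnat_dvd (indexgS A sPcore) _.
by case/and3P: sylP.
Qed.

Lemma maxnormal_factor_prime A M p q : pseudo_U42_solvable G -> A <| G -> maxnormal M A A ->
  prime p -> prime q -> 5 <= p -> 5 <= q -> p %| #|A / M| -> q %| #|A / M| -> p = q.
Proof.
move=> psG nAG maxM p_pr q_pr p5 q5; have nMA := maxnormal_normal maxM.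
have [ab|/U42_shapeP[-> _ _ _ _]] := pseudo_factor psG nAG maxM.
  have := simple_sol_prime (abelian_sol ab); rewrite quotient_simple // => /(_ maxM) prAM.
  by rewrite !dvdn_prime2 // => /eqP-> /eqP->.
have five r : prime r -> 5 <= r -> r %| (2 ^ 6 * 3 ^ 4 * 5)%N -> r = 5.
  move=> r_pr r5; rewrite (Euclid_dvdM (2 ^ 6 * 3 ^ 4) 5 r_pr) (Euclid_dvdM (2 ^ 6) (3 ^ 4) r_pr).
  rewrite (@dvdn_prime2 r 5 r_pr isT) => /orP[/orP[]|/eqP//] /(prime_dvd_exp r_pr);
    by move=> /(_ isT) Er; rewrite Er in r5.
by move=> /(five p p_pr p5)-> /(five q q_pr q5)->.
Qed.

End PseudoChief.

(** * Actions on U_4(2) composition factors *)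

Lemma no_order_quotient (gT : finGroupType) (G A M : {group gT}) n :
  A \subset G -> no_order G n -> no_order (A / M) n.
Proof.
move=> sAG noG _ /morphimP[x Nx Ax ->]; apply/eqP => on.
have dvn : n %| #[x] by rewrite -on morph_order.
have := noG (x ^+ (#[x] %/ n)) (groupX _ (subsetP sAG x Ax)).
rewrite orderXdiv ?dvdn_div // divnA // mulKn ?eqxx //.
Qed.

(** An [r]-group with a single subgroup of order [r] is cyclic, or generalised quaternion with
    [r = 2], and then has a cyclic subgroup of index 2. The bound [(r == 2).+1] covers both
    cases. *)
Lemma Ohm1_prime_cyclic_index (gT : finGroupType) (S : {group gT}) (r : nat) :
  r.-group S -> #|'Ohm_1(S)| = r -> prime r ->
  exists X : {group gT}, [/\ X \subset S, cyclic X & #|S : X| <= (r == 2).+1].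
Proof.
move=> rS oS r_pr; have ntS : S :!=: 1.
  by apply: contraTneq r_pr => S1; rewrite -oS S1 Ohm1 cards1.
have /(prime_Ohm1P rS ntS)/orP[cS|/andP[/eqP-> /eqP/quaternion_classP[n n_gt2 isoS]]] := oS.
  by exists S; rewrite subxx cS indexgg.
have [[x y] [oG Sx ox _] _] := generators_quaternion n_gt2 isoS.
exists <[x]>%G; rewrite cycle_subG Sx cycle_cyclic; split=> //.
rewrite /= -divgS ?cycle_subG // oG -orderE ox -(ltn_predK n_gt2) expnS mulnK //.
by rewrite expn_gt0.
Qed.

(** [E] meets the image of the cyclic subgroup [X] in a cyclic elementary abelian group, of order at
    most [r], and with index at most that of [X] in [S]. *)
Lemma abelem_sub_quotient_rank1 (gT : finGroupType) (S M : {group gT}) (E : {group coset_of M}) (r : nat) :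
  r.-group S -> #|'Ohm_1(S)| = r -> prime r -> S \subset 'N(M) -> E \subset S / M -> r.-abelem E ->
  #|E| <= (r == 2).+1 * r.
Proof.
move=> rS oS r_pr nMS sES abE; have [X [sXS cX iX]] := Ohm1_prime_cyclic_index rS oS r_pr.
have cEX : cyclic (E :&: X / M) := cyclicS (subsetIr _ _) (quotient_cyclic M cX).
have abEX : r.-abelem (E :&: X / M) := abelemS (subsetIl _ _) abE.
rewrite -(LagrangeI E (X / M)) mulnC; apply: leq_mul.
  have sub_rc : rcosets (X / M) E \subset rcosets (X / M) (S / M) by apply: imsetS.
  apply: (@leq_trans #|S / M : X / M|); first exact: subset_leq_card.
  apply: leq_trans iX; apply: dvdn_leq (indexg_gt0 _ _) (index_quotient _).
  by rewrite (subset_trans (subsetIl _ _)).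
apply: (@leq_trans (r ^ 1)); last by rewrite expn1.
by rewrite (card_pgroup (abelem_pgroup abEX)) leq_exp2l ?prime_gt1 // -abelem_cyclic.
Qed.

(* An elementary abelian r-subgroup of A / M that is too large for the quotient of a rank one r-group. *)
Lemma Frattini_order (gT : finGroupType) (G A M : {group gT}) (E : {group coset_of M}) (p r : nat) :
  prime p -> prime r -> r != p -> A \subset G -> M <| A -> p %| #|M| ->
  E \subset A / M -> r.-abelem E -> (r == 2).+1 * r < #|E| -> ~ no_order G (r * p)%N.
Proof.
move=> p_pr r_pr rp sAG nMA pM sEA abE ltE noG.
have [P sylP] := Sylow_exists p M; have sPM := pHall_sub sylP.
have sPA := subset_trans sPM (normal_sub nMA).
have ntP : P :!=: 1.
  by rewrite -cardG_gt1 (card_Hall sylP) p_part_gt1 mem_primes p_pr cardG_gt0.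
have defA := Frattini_arg nMA sylP.
have sLA : 'N_A(P) \subset A := subsetIl _ _.
have nML := subset_trans sLA (normal_norm nMA).
have LM : 'N_A(P) / M = A / M by rewrite -{2}defA quotientMidl.
(* [S] acts on [P], so it has rank one by [acting_Ohm1]. Since ['N_A(P)] covers [A / M], the image
   of [S] is a Sylow subgroup there and contains a conjugate of [E]. *)
have [S sylS] := Sylow_exists r 'N_A(P)%G; have sSL := pHall_sub sylS.
have nMS := subset_trans sSL nML.
have sylSM : r.-Sylow(A / M) (S / M) by rewrite -LM quotient_pHall.
have [x Ax sEx] := Sylow_Jsub sylSM sEA (abelem_pgroup abE).
have oE : #|E :^ x| = #|E| by rewrite cardJg.
have ntS : S :!=: 1.
  apply: contraTneq ltE => S1; rewrite -oE -leqNgt.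
  have := subset_leq_card sEx; rewrite /= S1 quotient1 cards1 => le1.
  by rewrite (leq_trans le1) // muln_gt0 (prime_gt0 r_pr).
have [sSA nPS] : S \subset A /\ S \subset 'N(P).
  by split; apply: subset_trans sSL _; [apply: subsetIl | apply: subsetIr].
have oS := acting_Ohm1 r_pr p_pr rp noG (subset_trans sSA sAG) (subset_trans sPA sAG)
  (pHall_pgroup sylS) ntS (pHall_pgroup sylP) ntP nPS.
have := @abelem_sub_quotient_rank1 _ S M (E :^ x)%G r (pHall_pgroup sylS) oS r_pr nMS sEx.
by rewrite /= abelemJ oE leqNgt ltE => /(_ abE).
Qed.

(** By Frattini's argument [C <*> <[y]>] is the product of [C] and the normaliser of [S]. As [p]
    does not divide [#|C|], this normaliser contains an element [z] of order [p], and the congruence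
    counts its fixed points. *)
Lemma Sylow_acted_on (gT : finGroupType) (C : {group gT}) y (p r : nat) :
    prime p -> y \in 'N(C) -> #[y] = p -> ~~ (p %| #|C|) ->
  exists z (S : {group gT}), [/\ r.-Sylow(C) S, z \in C <*> <[y]>, z \in 'N(S), #[z] = p
    & #|S| = #|'C_S[z]| %[mod p]].
Proof.
move=> p_pr nCy oy pC; have nCF : C <| C <*> <[y]>.
  by rewrite /normal joing_subl join_subG normG cycle_subG.
have [S sylS] := Sylow_exists r C; have FN := Frattini_arg nCF sylS.
have pF : p %| #|'N_(C <*> <[y]>)(S)|.
  have dvp : p %| #|C <*> <[y]>| by rewrite -oy order_dvdG // mem_gen // inE cycle_id orbT.
  have E := mul_cardG C 'N_(C <*> <[y]>)(S)%G; rewrite /= FN in E.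
  have: (p %| #|C| * #|'N_(C <*> <[y]>)(S)|)%N by rewrite E dvdn_mulr.
  by rewrite Euclid_dvdM // (negPf pC).
have [z /setIP[Fz nSz] oz] := Cauchy p_pr pF; exists z, S; split=> //.
have pz : p.-group <[z]> by rewrite /pgroup -orderE oz pnat_id.
have act : [acts <[z]>, on S | 'J].
  by rewrite /= astabsJ cycle_subG.
by rewrite (pgroup_fix_mod pz act) afixJ cent_cycle.
Qed.

Lemma Sylow_free_mod (gT : finGroupType) (G C : {group gT}) y (p r : nat) :
    prime p -> prime r -> r != p -> y \in 'N(C) -> #[y] = p -> ~~ (p %| #|C|) ->
    C \subset G -> y \in G -> no_order G (r * p)%N -> #|C|`_r = 1 %[mod p].
Proof.
move=> p_pr r_pr rp nCy oy pC sCG Gy noG.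
have [z [S [sylS Fz nSz oz modS]]] := Sylow_acted_on r p_pr nCy oy pC.
have Gz : z \in G by apply: subsetP Fz; rewrite join_subG sCG cycle_subG.
rewrite -(card_Hall sylS) modS; congr (_ %% _).
rewrite (no_order_cent p_pr r_pr _ _ _ (pHall_pgroup sylS) Gz) ?cards1 //.
- by rewrite eq_sym.
- by rewrite mulnC.
- exact: subset_trans (pHall_sub sylS) sCG.
- by rewrite /p_elt oz pnat_id.
- by rewrite -order_gt1 oz prime_gt1.
Qed.

(** For [r = 3], [p] would divide [81 - 1 = 2^4 * 5], which is impossible. For [r = 2], [p] divides
    [64 - 1 = 3^2 * 7], so [p = 7]; this is excluded by the element of order 3 whose centraliser has
    2-part 2, since 2 is not 1 modulo 7. *)
Lemma U42_action_order (gT : finGroupType) (G H : {group gT}) y (p r : nat) :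
  U42_shape H -> prime p -> 7 <= p -> y \in 'N(H) -> #[y] = p -> H \subset G -> y \in G ->
  r \in [:: 2; 3] -> ~ no_order G (r * p)%N.
Proof.
move=> [oH _ _ _ [t Ht [ot oC]]] p_pr p7 nHy oy sHG Gy r23 noG.
have oH2 : (#|H|`_2 = 64)%N.
  by rewrite p_part oH (@lognM 2 (2 ^ 6 * 3 ^ 4)%N 5) // (@lognM 2 (2 ^ 6) (3 ^ 4)) // !lognX !logn_prime.
have oH3 : (#|H|`_3 = 81)%N.
  by rewrite p_part oH (@lognM 3 (2 ^ 6 * 3 ^ 4)%N 5) // (@lognM 3 (2 ^ 6) (3 ^ 4)) // !lognX !logn_prime.
have small b k : p %| (b ^ k)%N -> prime b -> b < 7 -> false.
  by move=> pbk b_pr b7; rewrite (prime_dvd_exp p_pr b_pr pbk) leqNgt b7 in p7.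
have pH : ~~ (p %| #|H|).
  rewrite oH (Euclid_dvdM (2 ^ 6 * 3 ^ 4) 5 p_pr) (Euclid_dvdM (2 ^ 6) (3 ^ 4) p_pr).
  by apply/negP => /orP[/orP[/small|/small]|/(small 5 1%N)] /(_ isT isT).
have mod1 n : 0 < n -> n = 1 %[mod p] -> p %| n.-1.
  by move=> n_gt0 /eqP; rewrite eqn_mod_dvd // subn1.
move: r23; rewrite !inE => /pred2P[] r_; rewrite {r}r_ in noG; last first.
  have p3 : 3 != p by rewrite neq_ltn (leq_trans _ p7).
  have := @Sylow_free_mod _ G H y p 3 p_pr isT p3 nHy oy pH sHG Gy noG.
  rewrite oH3 => /(mod1 81 isT); rewrite -[81.-1]/(2 ^ 4 * 5 ^ 1)%N Euclid_dvdM //.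
  by case/orP => /small/(_ isT isT).
have p2 : 2 != p by rewrite neq_ltn (leq_trans _ p7).
have p_eq7 : p = 7.
  have := @Sylow_free_mod _ G H y p 2 p_pr isT p2 nHy oy pH sHG Gy noG.
  rewrite oH2 => /(mod1 64 isT); rewrite -[64.-1]/(3 ^ 2 * 7 ^ 1)%N Euclid_dvdM //.
  by case/orP => [/small/(_ isT isT)//|pp]; apply: prime_dvd_exp pp.
(* p = 7 centralises a Sylow 3-subgroup of H, hence a conjugate u of t, and so acts on C_H(u). *)
have [z [S [sylS Fz nSz oz modS]]] := Sylow_acted_on 3 p_pr nHy oy pH.
have Gz : z \in G by apply: subsetP Fz; rewrite join_subG sHG cycle_subG.
(* Among 1, 3, 9, 27, 81 only 81 is congruent to 81 modulo 7. *)
have CS : 'C_S[z] = S.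
  have oS : #|S| = (3 ^ 4)%N by rewrite (card_Hall sylS) oH3.
  have /(dvdn_pfactor _ _ (isT : prime 3))[k le_k4 oCS] : #|'C_S[z]| %| (3 ^ 4)%N.
    by rewrite -oS cardSg ?subsetIl.
  apply/eqP; rewrite eqEcard subsetIl oCS oS; move: modS; rewrite oCS oS p_eq7.
  by case: k le_k4 {oCS} => [|[|[|[|[|]]]]].
have [h Hh sub_t] : exists2 h, h \in H & <[t]> :^ h \subset S.
  by apply: (Sylow_Jsub sylS); rewrite ?cycle_subG // /pgroup -orderE ot.
have Su : t ^ h \in S by rewrite -cycle_subG cycleJ.
have czu : z \in 'C[t ^ h].
  by move: Su; rewrite -{1}CS inE => /andP[_]; rewrite cent1C.
have oC' : (#|'C_H[t ^ h]|`_2 = 2)%N.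
  have -> : 'C_H[t ^ h] = 'C_H[t] :^ h by rewrite conjIg conjGid // cent1J.
  by rewrite cardJg p_part oC.
have nHz : z \in 'N(H).
  by apply: subsetP Fz; rewrite join_subG normG cycle_subG.
have nCz : z \in 'N('C_H[t ^ h]).
  have uz : (t ^ h) ^ z = t ^ h by apply/conjg_fixP/commgP/commute_sym/cent1P.
  by apply/normP; rewrite conjIg (normP nHz) -cent1J uz.
have pC : ~~ (p %| #|'C_H[t ^ h]|).
  by apply: contra pH => /dvdn_trans; apply; apply: cardSg; apply: subsetIl.
have := @Sylow_free_mod _ G 'C_H[t ^ h] z p 2 p_pr isT p2 nCz oz pC _ Gz noG.
rewrite oC' => /(_ (subset_trans (subsetIl _ _) sHG)).
by rewrite p_eq7.
Qed.

Lemma maxnormal_quotient_full (gT : finGroupType) (A B M : {group gT}) :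
  maxnormal M A A -> B <| A -> ~~ (B \subset M) -> B / M = A / M.
Proof.
move=> maxM nBA nBM; have nMA := maxnormal_normal maxM; have [_ maxE] := maxgroupP maxM.
have sBA := normal_sub nBA; have nMB := subset_trans sBA (normal_norm nMA).
have [prMB|] := boolP ((M <*> B)%G \proper A).
  case/negP: nBM; rewrite -(maxE (M <*> B)%G _ (joing_subl _ _)) ?joing_subr //.
  by rewrite prMB normsY // ?normal_norm.
rewrite properE join_subG normal_sub // sBA /= negbK => sA.
apply/eqP; rewrite eqEsubset quotientS //=.
by rewrite (subset_trans (quotientS M sA)) // quotientYidl.
Qed.

(** Two normal subgroups of [A] not inside [M] both map onto [A / M]; if their intersection were
    inside [M], so would be their commutator, and [A / M] would be abelian. *)
Lemma bigcap_not_sub (gT : finGroupType) (I : finType) (P : pred I) (F : I -> {group gT}) (A M : {group gT}) :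
    maxnormal M A A -> ~~ abelian (A / M) -> (forall i, P i -> F i <| A /\ ~~ (F i \subset M)) ->
  exists C : {group gT}, [/\ C <| A, ~~ (C \subset M) & C = A :&: \bigcap_(i | P i) F i :> {set gT}].
Proof.
move=> maxM nabAM FP; have prMA := maxnormal_proper maxM.
elim/big_rec: _ => [|i X Pi [C [nCA nCM defC]]].
  by exists A; split; [apply: normal_refl | apply: proper_subn | rewrite setIT].
have [nFA nFM] := FP i Pi; exists (F i :&: C)%G; split.
- by rewrite normalI.
- apply: contra nabAM => sICM.
  rewrite /abelian -{1}(maxnormal_quotient_full maxM nFA nFM) -(maxnormal_quotient_full maxM nCA nCM).
  apply: quotient_cents2r; apply: subset_trans sICM.
  rewrite subsetI commg_subl commg_subr.
  by rewrite (subset_trans (normal_sub nCA) (normal_norm nFA))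
    (subset_trans (normal_sub nFA) (normal_norm nCA)).
- by rewrite /= defC setICA.
Qed.

Import FiniteModule.

(* If x moves M, then the product of the x-conjugates of an element c lying in M^g for every
   g in <[x]>^# but not in M is, modulo the core of M, a nontrivial element commuting with x. *)
Lemma permuted_action_order (gT : finGroupType) (G A M : {group gT}) x (p r : nat) :
  prime p -> prime r -> r != p -> A <| G -> maxnormal M A A -> ~~ abelian (A / M) ->
  x \in G -> #[x] = p -> x \notin 'N(M) -> ~~ (p %| #|A|) -> r %| #|A / M| ->
  ~ no_order G (r * p)%N.
Proof.
move=> p_pr r_pr rp nAG maxM nabAM Gx ox nMx pA rAM noG.
have nMA := maxnormal_normal maxM; have sMA := normal_sub nMA.
have sAG := normal_sub nAG.
have nAx : x \in 'N(A) := subsetP (normal_norm nAG) x Gx.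
have nAX g : g \in <[x]> -> g \in 'N(A) by apply: subsetP; rewrite cycle_subG.
have genx g : g \in <[x]>^# -> g \notin 'N(M).
  case/setD1P=> nt_g Xg; apply: contra nMx => nMg; rewrite -cycle_subG.
  by apply: prime_meetG; [rewrite -orderE ox | apply/trivgPn; exists g; rewrite // inE Xg].
have FP g : g \in <[x]>^# -> (M :^ g)%G <| A /\ ~~ ((M :^ g)%G \subset M).
  move=> Xg; have nAg : g \in 'N(A) by apply: nAX; case/setD1P: Xg.
  split; first by rewrite -(normP nAg) normalJ.
  by apply: contra (genx g Xg) => sMg; rewrite inE.
(* [C] is the intersection of [A] with the conjugates [M :^ g], [g] nontrivial in [<[x]>]. It is not
   inside [M], and [C :&: M] is the core [D]. *)
have [C [nCA nCM defC]] := bigcap_not_sub maxM nabAM FP.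
pose D := gcore M <[x]>.
have nDx : <[x]> \subset 'N(D) by apply: gcore_norm.
have sDM : D \subset M := gcore_sub M <[x]>.
have defD : C :&: M = D.
  rewrite defC setIAC (setIidPr sMA) /D /gcore [RHS](bigD1 1) ?group1 //= conjsg1; congr (M :&: _).
  by apply: eq_bigl => g; rewrite !inE andbC.
have nDA : A \subset 'N(D) by rewrite -defD normsI // normal_norm.
have [c [Cc nMc cr]] : exists c, [/\ c \in C, c \notin M & c ^+ r \in M].
  have := rAM; rewrite -(maxnormal_quotient_full maxM nCA nCM) => rCM.
  have [_ /morphimP[c Nc Cc ->] oc] := Cauchy r_pr rCM; exists c; split=> //.
    by apply/negP => /coset_id c1; move: r_pr; rewrite -oc /= c1 order1.
  by apply: coset_idr; rewrite ?groupX // morphX // -oc expg_order.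
have Ac : c \in A := subsetP (normal_sub nCA) c Cc.
have cgM g : g \in <[x]>^# -> c ^ g \in M.
  move=> Xg; have: c \in M :^ g^-1.
    move: Cc; rewrite defC => /setIP[_ /bigcapP/(_ g^-1)]; apply.
    by case/setD1P: Xg => nt_g Xg; rewrite !inE invg_eq1 nt_g groupV.
  by rewrite mem_conjgV.
have nDc : c \in 'N(D) := subsetP nDA c Ac.
have nDX g : g \in <[x]> -> g \in 'N(D) := subsetP nDx g.
have nDxx := nDX x (cycle_id x).
pose cb := coset D c; pose xb := coset D x.
have XbE k : k \in <[xb]> -> exists2 g, g \in <[x]> & k = coset D g.
  by rewrite -quotient_cycle // => /morphimP[g _ Xg ->]; exists g.
(* The commutator of [c] and [c ^ g] lies in both [C] and [M], hence in [D]. *)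
have cbc k : k \in <[xb]> -> commute cb (cb ^ k).
  move=> /XbE[g Xg ->]; have [->|nt_g] := eqVneq g 1.
    by rewrite morph1 conjg1.
  have Xg' : g \in <[x]>^# by rewrite !inE nt_g.
  have Acg : c ^ g \in A by rewrite memJ_norm // nAX.
  have nDg := nDX g Xg; have Ecg : cb ^ coset D g = coset D (c ^ g) by rewrite morphJ.
  apply/commgP; rewrite Ecg; have -> : [~ cb, coset D (c ^ g)] = coset D [~ c, c ^ g].
    by rewrite morphR ?groupJ.
  apply/eqP/coset_id.
  rewrite -defD inE commgEl groupM ?groupV //=; last by rewrite memJ_norm // (subsetP (normal_norm nCA)).
  by rewrite -commgEl commgEr groupM ?cgM // memJ_norm ?groupV ?cgM // (subsetP (normal_norm nMA)).
have abV : abelian <<cb ^: <[xb]> >>.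
  rewrite abelian_gen; apply/centsP => _ /imsetP[g Xg ->] _ /imsetP[h Xh ->].
  have Eh : cb ^ h = (cb ^ (h * g^-1)) ^ g by rewrite -conjgM mulgKV.
  rewrite Eh /commute -!conjMg; congr (_ ^ g).
  exact: cbc (groupM Xh (groupVr Xg)).
have nVx : <[xb]> \subset 'N(<<cb ^: <[xb]> >>) by rewrite norms_gen // class_norm.
have nVxb := subsetP nVx xb (cycle_id xb).
have Vc : cb \in <<cb ^: <[xb]> >> by rewrite mem_gen // class_refl.
have cbr : cb ^+ r = 1.
  by rewrite -morphX //; apply: coset_id; rewrite -defD inE groupX.
pose v := fmod abV cb; pose w := (\sum_(b in <[xb]>) v ^@ b)%R.
have wx : val w ^ xb = val w by rewrite -fmvalJ // actr_sum_orbit ?cycle_id.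
have wr : val w ^+ r = 1.
  rewrite -fmvalZ -sumrMnl big1 // => b Xb; rewrite -actZr -[X in actr X b]/(v *+ r)%R.
  have -> : (v *+ r = 0)%R by apply: val_inj; rewrite fmvalZ fmodK.
  by rewrite act0r.
have oxb : #[xb] = p.
  apply: nt_prime_order; rewrite // -?morphX // -?ox ?expg_order ?morph1 //.
  apply: contra pA => /eqP/coset_idr xD; rewrite -ox order_dvdG //.
  exact: subsetP (subset_trans sDM sMA) x (xD nDxx).
have noN : no_order ('N_G(D) / D) (r * p)%N.
  exact: no_order_quotient (subsetIl _ _) noG.
have Nxb : xb \in 'N_G(D) / D by rewrite mem_quotient // inE Gx.
have Ncb : cb \in 'N_G(D) / D by rewrite mem_quotient // inE (subsetP sAG).
have sVN : <<cb ^: <[xb]> >> \subset 'N_G(D) / D.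
  by rewrite gen_subG class_subG // cycle_subG.
have w1 : val w = 1.
  apply/eqP; apply: contraT => ntw; have ow : #[val w] = r by apply: nt_prime_order.
  case: (no_order_commute r_pr p_pr rp noN (subsetP sVN _ (fmodP w)) Nxb ow oxb).
  exact/commgP/conjg_fixP.
(* The other conjugates of [c] lie in [M]; as the whole product is trivial modulo [D], so would
   [c]. *)
have rest : val (\sum_(b in <[xb]> | b != 1%g) v ^@ b)%R \in M / D.
  elim/big_ind: _ => [|u1 u2 Mu1 Mu2|b /andP[Xb ntb]]; first exact: group1.
    by rewrite fmvalA groupM.
  rewrite fmvalJ ?(subsetP nVx) // fmodK //; have [g Xg defb] := XbE b Xb.
  have -> : cb ^ b = coset D (c ^ g) by have nDg := nDX g Xg; rewrite defb morphJ.
  apply: mem_quotient; apply: cgM; rewrite !inE Xg andbT.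
  by apply: contraNneq ntb => g1; rewrite defb g1 morph1.
case/negP: nMc; have: cb \in M / D.
  move: w1; rewrite /w (bigD1 1) ?group1 //= fmvalA actr1 fmodK // => /eqP.
  by rewrite -eq_invg_mul => /eqP Ew; rewrite -groupV Ew.
have nDM : D <| M by rewrite /normal sDM (subset_trans sMA).
by move=> cbM; rewrite -(quotientGK nDM) mem_morphpre.
Qed.

(** * Complements of prime graphs *)

Section Forward.

Variables (gT : finGroupType) (G : {group gT}).
Implicit Types (A B M N L P Q R S : {group gT}) (p q r s : nat).

(** A minimal nonsolvable normal subgroup [A] is perfect, since a smaller derived subgroup would be
    solvable and make [A] solvable. Hence [A / M] is not abelian. *)
Lemma nonsolvable_U42_factor : pseudo_U42_solvable G -> ~~ solvable G ->
  exists A M : {group gT}, [/\ A <| G, maxnormal M A A, ~~ abelian (A / M) & A / M \isog U42].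
Proof.
move=> psG nsG.
have [|A minA sAG] := @mingroup_exists _ (fun B : {group gT} => (B <| G) && ~~ solvable B) G.
  by rewrite normal_refl.
have [/andP[nAG nsA] minE] := mingroupP minA.
have ntA : A :!=: 1 by apply: contraNneq nsA => ->; apply: solvable1.
have [M maxM] := ex_maxnormal_ntrivg ntA.
have perfA : A^`(1) = A.
  apply/eqP; apply: contraNT nsA => neA.
  have nA'G : A^`(1) <| G by apply: gFnormal_trans.
  have sol' : solvable A^`(1).
    apply: contraT => ns'; case/eqP: neA; apply: (minE [group of A^`(1)]); last exact: der_sub.
    by rewrite /= nA'G.
  rewrite (series_sol (der_normal 1 A)) sol' /= abelian_sol //.
  exact: der_abelian.
have nabAM : ~~ abelian (A / M).
  apply/negP => abAM; have := maxnormal_proper maxM; rewrite properE -{2}perfA.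
  by rewrite der1_min ?andbF // normal_norm // maxnormal_normal.
exists A, M; split=> //; have [abAM|//] := pseudo_factor psG nAG maxM.
by rewrite abAM in nabAM.
Qed.

Lemma nonsolvable_order6 : pseudo_U42_solvable G -> ~~ solvable G -> ~ no_order G 6.
Proof.
move=> psG nsG noG; have [A [M [nAG maxM _ isoU]]] := nonsolvable_U42_factor psG nsG.
have [_ _ _ [x Ax ox] _] := U42_shapeP isoU.
by have := no_order_quotient (normal_sub nAG) noG Ax; rewrite ox eqxx.
Qed.

(** There are three cases. If [p] divides [#|M|], the subgroups 2^3 and 3^2 of [A / M] are too large
    for [Frattini_order]. Otherwise [p] does not divide [#|A|], and an element of order [p] either
    moves [M] or acts on [A / M]. *)
Lemma nonsolvable_order_ge7 p r : pseudo_U42_solvable G -> ~~ solvable G ->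
  prime p -> 7 <= p -> p %| #|G| -> r \in [:: 2; 3] -> ~ no_order G (r * p)%N.
Proof.
move=> psG nsG p_pr p7 pG r23 noG.
have [A [M [nAG maxM nabAM isoU]]] := nonsolvable_U42_factor psG nsG.
have shU := U42_shapeP isoU; have [oAM [E2 sE2 [abE2 oE2]] [E3 sE3 [abE3 oE3]] _ _] := shU.
have [r_pr rp] : prime r /\ r != p.
  by move: r23; rewrite !inE => /pred2P[]->; rewrite neq_ltn (leq_trans _ p7).
have nMA := maxnormal_normal maxM; have sAG := normal_sub nAG.
have [pM|pM] := boolP (p %| #|M|).
  move: r23; rewrite !inE => /pred2P[] r_; rewrite {r}r_ in noG r_pr rp.
    by apply: (Frattini_order p_pr r_pr rp sAG nMA pM sE2 abE2 _ noG); rewrite oE2.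
  by apply: (Frattini_order p_pr r_pr rp sAG nMA pM sE3 abE3 _ noG); rewrite oE3.
have pAM : ~~ (p %| #|A / M|).
  rewrite oAM (Euclid_dvdM (2 ^ 6 * 3 ^ 4) 5 p_pr) (Euclid_dvdM (2 ^ 6) (3 ^ 4) p_pr).
  have small b k : p %| (b ^ k)%N -> prime b -> b < 7 -> false.
    by move=> pbk b_pr b7; rewrite (prime_dvd_exp p_pr b_pr pbk) leqNgt b7 in p7.
  by apply/negP => /orP[/orP[/small|/small]|/(small 5 1%N)] /(_ isT isT).
have pA : ~~ (p %| #|A|).
  by rewrite -(Lagrange (normal_sub nMA)) -card_quotient ?normal_norm // Euclid_dvdM // negb_or pM.
have [x Gx ox] := Cauchy p_pr pG.
have [nMx|nMx] := boolP (x \in 'N(M)); last first.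
  apply: (permuted_action_order p_pr r_pr rp nAG maxM nabAM Gx ox nMx pA _ noG).
  rewrite oAM; move: r23; rewrite !inE => /pred2P[]->; apply: dvdn_mulr.
    by rewrite dvdn_mulr // dvdn_exp.
  by rewrite dvdn_mull // dvdn_exp.
have noN : no_order ('N_G(M) / M) (r * p)%N by apply: no_order_quotient noG; apply: subsetIl.
have nHy : coset M x \in 'N(A / M).
  have nAx := subsetP (normal_norm nAG) x Gx.
  by apply: (subsetP (quotient_norm M A)); apply: mem_quotient.
have oxb : #[coset M x] = p.
  apply: nt_prime_order; rewrite // -?morphX // -?ox ?expg_order ?morph1 //.
  apply: contra pM => /eqP/coset_idr xM; rewrite -ox order_dvdG //; exact: xM.
apply: (U42_action_order (H := A / M) shU p_pr p7 nHy oxb _ _ r23 noN).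
  by apply: quotientS; rewrite subsetI sAG normal_norm.
by apply: mem_quotient; rewrite inE Gx.
Qed.

Lemma chief_factor_solvable A B p q : solvable G -> chief_factor G B A ->
  prime p -> prime q -> p %| #|A : B| -> q %| #|A : B| -> p = q.
Proof.
move=> solG chf p_pr q_pr pAB qAB; have /andP[maxB nAG] := chf.
have /andP[prBA nBG] := maxgroupp maxB; have sAG := normal_sub nAG.
have nBA : B <| A by rewrite /normal proper_sub // (subset_trans sAG).
have [M maxM sBM] := exists_maxnormal_over nBA prBA.
have := simple_sol_prime (quotient_sol M (solvableS sAG solG)).
rewrite quotient_simple ?maxnormal_normal // => /(_ maxM) prAM.
have := chief_factor_prime chf maxM sBM p_pr pAB; have := chief_factor_prime chf maxM sBM q_pr qAB.
by rewrite !dvdn_prime2 // => /eqP-> /eqP->.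
Qed.

Lemma chief_factor_pseudo A B p q : pseudo_U42_solvable G -> chief_factor G B A ->
  prime p -> prime q -> 5 <= p -> 5 <= q -> p %| #|A : B| -> q %| #|A : B| -> p = q.
Proof.
move=> psG chf p_pr q_pr p5 q5 pAB qAB; have /andP[maxB nAG] := chf.
have /andP[prBA nBG] := maxgroupp maxB; have sAG := normal_sub nAG.
have nBA : B <| A by rewrite /normal proper_sub // (subset_trans sAG).
have [M maxM sBM] := exists_maxnormal_over nBA prBA.
apply: (maxnormal_factor_prime psG nAG maxM p_pr q_pr p5 q5).
  exact: chief_factor_prime chf maxM sBM p_pr pAB.
exact: chief_factor_prime chf maxM sBM q_pr qAB.
Qed.

Definition three_colored (Pi : pred nat) := exists c : nat -> nat,
  (forall p, c p < 3) /\ (forall p q, in_Pi G Pi p -> in_Pi G Pi q -> nonadj G p q -> c p != c q).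

(* Colour 0: no neighbour above; 2: neighbours above but none below; 1: both. Two adjacent vertices
   of colour 1 would be the middle of a descending path with four vertices. *)
Lemma chief_three_colored (Pi : pred nat) :
  (forall A B, chief_factor G B A -> forall p q, prime p -> prime q -> Pi p -> Pi q ->
     p %| #|A : B| -> q %| #|A : B| -> p = q) ->
  three_colored Pi.
Proof.
move=> chf; pose nadj p q := (p != q) && [forall x in G, #[x] != p * q]%N.
have nadjP p q : nonadj G p q <-> nadj p q.
  split=> [[pq no]|/andP[pq /forall_inP no]]; last by split.
  by rewrite /nadj pq; apply/forall_inP.
pose pos := chief_pos G.
pose up p := has (fun q => [&& Pi q, pos q < pos p & nadj q p]) (primes #|G|).
pose dn p := has (fun q => [&& Pi q, pos p < pos q & nadj p q]) (primes #|G|).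
have hasPi p : in_Pi G Pi p -> p \in primes #|G|.
  by case=> p_pr _ pG; rewrite mem_primes p_pr cardG_gt0.
have Pi_mem p : p \in primes #|G| -> Pi p -> in_Pi G Pi p.
  by rewrite mem_primes => /and3P[p_pr _ pG] Pp.
exists (fun p => if up p then if dn p then 1 else 2 else 0)%N; split=> [p|p q].
  by case: ifP => // _; case: ifP.
have edge p1 q1 : in_Pi G Pi p1 -> in_Pi G Pi q1 -> nonadj G p1 q1 -> pos p1 < pos q1 ->
    (if up p1 then if dn p1 then 1 else 2 else 0)%N != (if up q1 then if dn q1 then 1 else 2 else 0)%N.
  move=> Pp Pq npq lt_pq; have dnp : dn p1.
    by apply/hasP; exists q1; [apply: hasPi | rewrite lt_pq; have [_ -> _] := Pq; apply/nadjP].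
  have upq : up q1.
    by apply/hasP; exists p1; [apply: hasPi | rewrite lt_pq; have [_ -> _] := Pp; apply/nadjP].
  rewrite dnp upq; have [upp|_] := boolP (up p1); last by case: (dn q1).
  have [dnq|//] := boolP (dn q1); exfalso.
  have [o Go /and3P[Po lt_op /nadjP nop]] := hasP upp.
  have [s Gs /and3P[Ps lt_qs /nadjP nqs]] := hasP dnq.
  exact: (no_descending4 (Pi_mem o Go Po) Pp Pq (Pi_mem s Gs Ps) lt_op lt_pq lt_qs nop npq nqs).
move=> Pp Pq npq; have [p_pr Pip pG] := Pp; have [q_pr Piq qG] := Pq.
have [lt_pq|lt_qp|eq_pq] := ltngtP (pos p) (pos q).
- exact: edge.
- by rewrite eq_sym; apply: edge => //; apply: nonadj_sym.
- by have := nonadj_neq npq; rewrite (chief_pos_inj chf p_pr q_pr Pip Piq pG qG eq_pq) eqxx.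
Qed.

Lemma pseudo_complement : pseudo_U42_solvable G ->
  three_colored predT /\
  (forall p q r, in_Pi G predT p -> in_Pi G predT q -> in_Pi G predT r ->
     nonadj G p q -> nonadj G q r -> nonadj G p r -> False).
Proof.
move=> psG; have [solG|nsG] := boolP (solvable G).
  have chf A B : chief_factor G B A -> forall p q, prime p -> prime q -> predT p -> predT q ->
      p %| #|A : B| -> q %| #|A : B| -> p = q.
    by move=> chAB p q p_pr q_pr _ _; apply: chief_factor_solvable chAB p_pr q_pr.
  split; first exact: chief_three_colored.
  exact: no_nonadj_triangle.
pose Pi p := 5 <= p.
have chf A B : chief_factor G B A -> forall p q, prime p -> prime q -> Pi p -> Pi q ->
    p %| #|A : B| -> q %| #|A : B| -> p = q.
  by move=> chAB p q p_pr q_pr p5 q5; apply: chief_factor_pseudo psG chAB p_pr q_pr p5 q5.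
have inPi p : in_Pi G predT p -> 5 <= p -> in_Pi G Pi p by case.
have small p : prime p -> p < 5 -> p \in [:: 2; 3] by case: p => [|[|[|[|[|]]]]].
(* The only vertex possibly nonadjacent to 2 or 3 is 5. *)
have pendant p q : in_Pi G predT p -> in_Pi G predT q -> nonadj G p q -> p < 5 -> q = 5.
  move=> [p_pr _ _] [q_pr _ qG] [pq npq] p5; have p23 := small p p_pr p5.
  have [q7|] := leqP 7 q; first by case: (nonsolvable_order_ge7 psG nsG q_pr q7 qG p23 npq).
  have [//|q5] := eqVneq q 5; have [q5'|] := ltnP q 5; last first.
    case: q q5 q_pr {qG pq npq} => [|[|[|[|[|[|[|q]]]]]]] //.
  have q23 := small q q_pr q5'; case: (nonsolvable_order6 psG nsG).
  move: p23 q23 pq npq; rewrite !inE.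
  by case/pred2P=> -> /pred2P[]->.
have ge5 p q : in_Pi G predT p -> in_Pi G predT q -> nonadj G p q -> p < 5 -> ~~ (q < 5).
  by move=> Pp Pq npq p5; rewrite (pendant p q Pp Pq npq p5).
split.
  have [c [c3 cP]] := chief_three_colored chf.
  (* The boolean, read as a number, is a colour different from that of 5; it serves for both 2 and
     3. *)
  exists (fun p => if p < 5 then (c 5 == 0%N : nat) else c p); split=> [p|p q Pp Pq npq].
    by case: ifP => // _; case: (c 5 == 0%N).
  have c5 : (c 5 == 0%N : nat) != c 5 by case: (c 5).
  have [p5|p5] := ltnP p 5.
    by rewrite (pendant p q).
  have [q5|q5] := ltnP q 5; last by apply: cP => //; apply: inPi.
  by rewrite eq_sym (pendant q p) //; apply: nonadj_sym.
move=> p q r Pp Pq Pr pq qr pr; have [p5|p5] := ltnP p 5.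
  have := nonadj_neq qr; rewrite (pendant p q Pp Pq pq p5) (pendant p r Pp Pr pr p5).
  by rewrite eqxx.
have [q5|q5] := ltnP q 5.
  have := nonadj_neq pr; rewrite (pendant q p Pq Pp (nonadj_sym pq) q5) (pendant q r Pq Pr qr q5).
  by rewrite eqxx.
have [r5|r5] := ltnP r 5.
  have := nonadj_neq pq; rewrite (pendant r p Pr Pp (nonadj_sym pr) r5)
    (pendant r q Pr Pq (nonadj_sym qr) r5).
  by rewrite eqxx.
by apply: (no_nonadj_triangle chf (inPi _ Pp _) (inPi _ Pq _) (inPi _ Pr _)).
Qed.

Lemma compl_adj_nonadj (u v : prime_graph G) : adj (s := compl_graph (prime_graph G)) u v ->
  nonadj G (val u) (val v).
Proof.
rewrite /= => /andP[uv]; rewrite /prime_adj /= negb_and => /orP[/negP[]//|].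
rewrite negb_exists => /forallP no; split=> // x Gx.
by have := no x; rewrite Gx.
Qed.

Lemma prime_graph_in_Pi (u : prime_graph G) : in_Pi G predT (val u).
Proof. by have := valP u; rewrite mem_primes => /and3P[]. Qed.

End Forward.

Lemma forward (X : sgraph) (gT : finGroupType) (G : {group gT}) :
  pseudo_U42_solvable G -> graph_iso X (prime_graph G) ->
  colorable 3 (compl_graph X) /\ triangle_free (compl_graph X).
Proof.
move=> psG [f bij_f f_adj]; have [[c [c3 cP]] tri] := pseudo_complement psG.
have Pf x := prime_graph_in_Pi (f x).
have edge x y : adj (s := compl_graph X) x y -> nonadj G (val (f x)) (val (f y)).
  move=> xy; apply: compl_adj_nonadj; move: xy.
  by rewrite /= /compl_adj /= (inj_eq (bij_inj bij_f)) -f_adj.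
split.
  by exists (fun x => Ordinal (c3 (val (f x)))) => x y xy; rewrite -val_eqE /=; apply: cP (edge x y xy).
move=> x y z; apply/negP => /and3P[xy yz xz].
exact: (tri _ _ _ (Pf x) (Pf y) (Pf z) (edge x y xy) (edge y z yz) (edge x z xz)).
Qed.

(** * Extension by an induced module *)

(** The regular wreath product of the additive group of F_r by [gT]; the modules induced from all
    subgroups lie in its base group. *)
Definition wreath (gT : finGroupType) (r : nat) : Type := ({ffun gT -> 'F_r} * gT)%type.

HB.instance Definition _ gT r := Finite.on (wreath gT r).

Section Wreath.

Variables (gT : finGroupType) (r : nat).
Local Notation W := (wreath gT r).

Definition translate (x : gT) (f : {ffun gT -> 'F_r}) : {ffun gT -> 'F_r} := [ffun z => f (z * x)].

Definition wreath_mul (u v : W) : W := ((u.1 + translate u.2 v.1)%R, u.2 * v.2).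
Definition wreath_one : W := (0%R, 1).
Definition wreath_inv (u : W) : W := ((- translate (u.2^-1)%g u.1)%R, u.2^-1).

Fact wreath_mulA : associative wreath_mul.
Proof.
move=> u v w; congr pair; last exact: mulgA.
by apply/ffunP => z; rewrite !ffunE addrA mulgA.
Qed.

Fact wreath_mul1 : left_id wreath_one wreath_mul.
Proof.
case=> f x; congr pair; last exact: mul1g.
by apply/ffunP => z; rewrite !ffunE add0r mulg1.
Qed.

Fact wreath_mulV : left_inverse wreath_one wreath_inv wreath_mul.
Proof.
case=> f x; congr pair; last exact: mulVg.
by apply/ffunP => z; rewrite !ffunE addNr.
Qed.

HB.instance Definition _ := Finite_isGroup.Build W wreath_mulA wreath_mul1 wreath_mulV.

Lemma wreathM1 (u v : W) : (u * v).1 = (u.1 + translate u.2 v.1)%R. Proof. by []. Qed.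

End Wreath.

(** * The module induced from a linear character, and the orders of elements in the extension *)

Section Extension.

Variables (gT : finGroupType) (K L : {group gT}) (r : nat) (lam : gT -> 'F_r).
Hypotheses (r_pr : prime r) (rK : ~~ (r %| #|K|)) (nLK : L <| K).
Hypotheses (lamM : {in L &, forall x y, lam (x * y) = lam x * lam y}%R) (lam1 : lam 1 = 1%R).

Local Notation W := (wreath gT r).

(** The module induced from [lam], as functions on [K] extended by zero to [gT]. Right translation
    by [K] commutes with the condition on left multiplication by [L]. *)
Definition equivariant : {set {ffun gT -> 'F_r}} :=
  [set f : {ffun gT -> 'F_r} | [forall z, (z \notin K) ==> (f z == 0)%R] &&
     [forall l in L, forall z, f (l * z) == (lam l * f z)%R]].

Lemma equivariantP (f : {ffun gT -> 'F_r}) : reflect ((forall z, z \notin K -> f z = 0%R) /\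
  (forall l z, l \in L -> f (l * z) = (lam l * f z)%R)) (f \in equivariant).
Proof.
rewrite inE; apply: (iffP andP) => [[/forallP f0 /forall_inP fL]|[f0 fL]]; split.
- by move=> z Kz; have := f0 z; rewrite Kz => /eqP.
- by move=> l z Ll; have /forallP/(_ z)/eqP := fL l Ll.
- by apply/forallP => z; apply/implyP => Kz; rewrite f0.
- by apply/forall_inP => l Ll; apply/forallP => z; rewrite fL.
Qed.

Definition extension_set : {set W} := [set u : W | (u.1 \in equivariant) && (u.2 \in K)].

Lemma in_extension u : (u \in extension_set) = (u.1 \in equivariant) && (u.2 \in K).
Proof. by rewrite in_set. Qed.

Fact extension_group_set : group_set extension_set.
Proof.
apply/group_setP; split.
  rewrite in_extension group1 andbT; apply/equivariantP; split=> [z _|l z _]; rewrite !ffunE //.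
  by rewrite mulr0.
move=> u v; rewrite !in_extension => /andP[/equivariantP[u0 uL] Ku] /andP[/equivariantP[v0 vL] Kv].
rewrite groupM // andbT wreathM1; apply/equivariantP; split=> [z Kz|l z Ll]; rewrite !ffunE.
  by rewrite u0 // v0 ?addr0 // groupMr.
by rewrite uL // -mulgA (vL l) // mulrDr.
Qed.
Definition extension : {group W} := Group extension_group_set.

Definition embed (x : gT) : W := (0%R, x).
Definition project (u : W) : gT := u.2.

Lemma embedM x y : embed (x * y) = embed x * embed y.
Proof. by congr pair; apply/ffunP => z; rewrite !ffunE addr0. Qed.

Lemma embed_in x : x \in K -> embed x \in extension.
Proof.
by move=> Kx; rewrite in_extension Kx andbT; apply/equivariantP; split=> [z _|l z _]; rewrite !ffunE ?mulr0.
Qed.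

Lemma projectM : {morph project : u v / u * v}. Proof. by []. Qed.

Lemma project_in u : u \in extension -> project u \in K.
Proof. by rewrite in_extension => /andP[]. Qed.

Lemma order_embed x : #[embed x] = #[x].
Proof.
have eX n : embed x ^+ n = embed (x ^+ n).
  elim: n => [|n IH]; first by rewrite !expg0.
  by rewrite !expgS IH embedM.
apply/eqP; rewrite eqn_dvd !order_dvdn eX expg_order eqxx /=.
have := congr1 project (expg_order (embed x)); rewrite eX /project /= => ->.
by rewrite eqxx.
Qed.

Lemma projectX u n : project (u ^+ n) = project u ^+ n.
Proof. by elim: n => [|n IH]; rewrite ?expg0 // !expgS projectM IH. Qed.

Lemma kernel_exp u n : project u = 1 -> u ^+ n = ((u.1 *+ n)%R, 1).
Proof.
move=> u1; elim: n => [|n IH]; first by rewrite expg0.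
rewrite expgS IH; congr pair; last by rewrite /= -/(project u) u1 mulg1.
apply/ffunP => z; rewrite !ffunE -/(project u) u1 mulg1 mulrS ffunE //.
Qed.

Lemma kernel_expr u : project u = 1 -> u ^+ r = 1.
Proof.
move=> u1; rewrite kernel_exp //; congr pair; apply/ffunP => z.
by rewrite ffunMnE ffunE mulrn_pchar // pchar_Fp.
Qed.

Lemma order_project u p : prime p -> p != r -> #[u] = p -> #[project u] = p.
Proof.
move=> p_pr pr ou; apply: nt_prime_order => //; first by rewrite -projectX -ou expg_order.
apply: contra pr => /eqP/kernel_expr ur.
by rewrite -dvdn_prime2 // -ou order_dvdn ur.
Qed.

Lemma order_kernel u : u \in extension -> #[u] = r -> project u = 1.
Proof.
move=> Ku ou; apply/eqP; apply: contraT => ntu.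
have : #[project u] = r.
  by apply: nt_prime_order => //; rewrite -projectX; have := expg_order u; rewrite ou => ->.
by move=> o; case/negP: rK; rewrite -{1}o order_dvdG // project_in.
Qed.

Lemma extension_sol : solvable K -> solvable extension.
Proof.
move=> solK; pose f := Morphism (in2W projectM : {in extension &, {morph project : u v / u * v}}).
rewrite (series_sol (ker_normal f)); apply/andP; split.
  apply: (@pgroup_sol _ r); apply/pgroupP => q q_pr /(Cauchy q_pr)[u /morphpreP[Ku /set1P u1] ou].
  by rewrite inE -dvdn_prime2 // -ou order_dvdn kernel_expr.
rewrite (isog_sol (first_isog f)); apply: solvableS solK.
by apply/subsetP => _ /morphimP[u _ Ku ->]; apply: project_in.
Qed.

Lemma extension_prime p : prime p -> p %| #|extension| -> p = r \/ p %| #|K|.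
Proof.
move=> p_pr /(Cauchy p_pr)[u Ku ou]; have [->|pr] := eqVneq p r; first by left.
by right; rewrite -(order_project p_pr pr ou) order_dvdG // project_in.
Qed.

Lemma extension_dvd p : prime p -> p %| #|K| -> p %| #|extension|.
Proof.
move=> p_pr /(Cauchy p_pr)[x Kx ox].
by rewrite -ox -order_embed order_dvdG // embed_in.
Qed.

Lemma no_order_extension n : coprime n r -> no_order extension n <-> no_order K n.
Proof.
move=> co_nr; split=> no x Kx; first by rewrite -order_embed no ?embed_in.
apply/eqP => ox; case/eqP: (no _ (project_in Kx)); apply/eqP.
rewrite eqn_dvd order_dvdn -projectX -ox expg_order eqxx /=.
by rewrite -ox in co_nr; rewrite -(Gauss_dvdl _ co_nr) order_dvdn expgM kernel_expr // projectX expg_order.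
Qed.

Lemma lam_neq0 l : l \in L -> lam l != 0%R.
Proof.
move=> Ll; apply: contraTneq isT => l0; have := lamM Ll (groupVr Ll).
by rewrite mulgV lam1 l0 mul0r => /eqP; rewrite oner_eq0.
Qed.

Lemma lamV l : l \in L -> lam l^-1 = ((lam l)^-1)%R.
Proof.
move=> Ll; apply: (mulIf (lam_neq0 Ll)); rewrite mulVf ?lam_neq0 //.
by rewrite -lamM ?groupV // mulVg.
Qed.

(* Averaging the delta function at 1 over L, twisted by lam, and over <[x]>. *)
Lemma exists_fixed_equivariant x : x \in K -> (forall z, z \in L -> z \in <[x]> -> lam z = 1%R) ->
  exists2 f, f \in equivariant & f != 0%R /\ translate x f = f.
Proof.
move=> Kx lam_x.
pose f : {ffun gT -> 'F_r} :=
  [ffun y => (\sum_(l in L) \sum_(z in <[x]>) (lam l)^-1 *+ ((l * y * z)%g == 1%g))%R].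
have sLK := normal_sub nLK.
exists f; first apply/equivariantP; split.
- move=> y nKy; rewrite ffunE big1 // => l Ll; rewrite big1 // => z Xz.
  have [lyz|//] := eqVneq; case/negP: nKy.
  have -> : y = l^-1 * z^-1 by rewrite -[LHS](mulKg l) -[l * y](mulgK z) lyz mul1g.
  have Kl := subsetP sLK l Ll.
  have Kz : z \in K by apply: (subsetP _ z Xz); rewrite cycle_subG.
  by rewrite groupM ?groupV.
- move=> l y Ll; rewrite !ffunE (reindex_inj (mulIg l^-1)) mulr_sumr /=.
  apply: eq_big => [l1|l1 Ll1]; first by rewrite groupMr ?groupV.
  rewrite groupMr ?groupV // in Ll1.
  rewrite mulr_sumr; apply: eq_bigr => z Xz; rewrite mulgA mulgKV.
  by rewrite lamM ?groupV // lamV // invfM invrK mulrnAr mulrC.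
(* As [lam] is trivial on [L :&: <[x]>], the value at 1 is the order of this group, which is nonzero
   modulo [r]. *)
- have f1 : f 1 = (#|L :&: <[x]>|%:R)%R.
    rewrite ffunE -sum1_card natr_sum big_mkcond [RHS]big_mkcond /=.
    apply: eq_bigr => l _; rewrite inE; case: (boolP (l \in L)) => //= Ll.
    case: ifP => Xl.
      rewrite (bigD1 l^-1) ?groupV //= mulg1 mulgV eqxx lam_x // invr1 mulr1n.
      rewrite big1 ?addr0 // => z /andP[_ nz].
      by rewrite -eq_invg_mul eq_sym (negPf nz).
    rewrite big1 // => z Xz; rewrite mulg1 -eq_invg_mul.
    by case: eqP => // lz; rewrite -groupV lz Xz in Xl.
  apply/negP => /eqP f0; move: f1; rewrite f0 ffunE => /esym/eqP.
  rewrite -(dvdn_pcharf (pchar_Fp r_pr)) => dvr; case/negP: rK.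
  by apply: dvdn_trans dvr (cardSg _); apply: subset_trans (subsetIl _ _) sLK.
- apply/ffunP => y; rewrite !ffunE; apply: eq_bigr => l Ll.
  rewrite (reindex_inj (mulgI x^-1)) /=; apply: eq_big => [z|z _].
    by rewrite groupMl // groupV cycle_id.
  by rewrite !mulgA mulgK.
Qed.

Lemma extension_adj x p : prime p -> p != r -> x \in K -> #[x] = p ->
  x \notin L \/ lam x = 1%R -> ~ no_order extension (p * r)%N.
Proof.
move=> p_pr pr Kx ox xL noK.
(* [L :&: <[x]>] is either trivial or [<[x]>], as [x] has prime order. *)
have lam_x z : z \in L -> z \in <[x]> -> lam z = 1%R.
  move=> Lz Xz; have [Lx|nLx] := boolP (x \in L); last first.
    have tiX : <[x]> :&: L = 1 by rewrite prime_TIg -?orderE ?ox // cycle_subG.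
    have: z \in <[x]> :&: L by rewrite inE Xz.
    by rewrite tiX => /set1P->.
  case: xL => [|lx1]; first by rewrite Lx.
  case/cycleP: Xz => k ->; elim: k => [|k IH]; first by rewrite expg0.
  by rewrite expgS lamM ?groupX // lx1 IH mulr1.
have [f Ef [nzf fx]] := exists_fixed_equivariant Kx lam_x.
pose m : W := (f, 1); have Km : m \in extension by rewrite in_extension Ef group1.
have om : #[m] = r.
  apply: nt_prime_order => //; first exact: kernel_expr.
  by apply: contra nzf => /eqP[->].
apply: (no_order_commute p_pr r_pr pr noK (embed_in Kx) Km _ om); first by rewrite order_embed.
congr pair; last by rewrite /= mulg1 mul1g.
by rewrite /= add0r fx; apply/ffunP => z; rewrite !ffunE addr0.
Qed.

(** An element of order [p r] would yield a nonzero module element [m] fixed by some [x] of order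
    [p] in [K]. Where [m z] is nonzero, [m z = m (z x) = lam (z x z^-1) m z], so [lam] is 1 at a
    conjugate of [x]. *)
Lemma extension_nonadj p : prime p -> p != r ->
    (forall x, x \in K -> #[x] = p -> x \in L /\ lam x != 1%R) -> no_order extension (p * r)%N.
Proof.
move=> p_pr pr xL g Kg; apply/eqP => og.
have Kgp : g ^+ p \in extension by rewrite groupX.
have Kgr : g ^+ r \in extension by rewrite groupX.
have ogp : #[g ^+ p] = r by rewrite orderXdiv og ?dvdn_mulr // mulKn ?prime_gt0.
have ogr : #[g ^+ r] = p by rewrite orderXdiv og ?dvdn_mull // mulnK ?prime_gt0.
have g1 := order_kernel Kgp ogp; have ox := order_project p_pr pr ogr.
set x := project _ in ox; have Kx : x \in K := project_in Kgr.
have : g ^+ r * g ^+ p = g ^+ p * g ^+ r by rewrite -!expgD addnC.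
move/(congr1 (fun u : W => u.1)); rewrite !wreathM1 -/(project _) -/(project (g ^+ p)) g1.
have tr1 h : translate 1 h = h :> {ffun gT -> 'F_r} by apply/ffunP => z; rewrite ffunE mulg1.
rewrite tr1 addrC => /addIr fix_x.
have [/equivariantP[m0 mL] _] : _ /\ _ := andP (etrans (esym (in_extension _)) Kgp).
have nzm : (g ^+ p).1 != 0%R.
  apply/negP => /eqP m0'; have gp1 : g ^+ p = 1.
    by rewrite [LHS]surjective_pairing m0' -/(project _) g1.
  by have /eqP := ogp; rewrite gp1 order1 ltn_eqF ?prime_gt1.
have [z Kz nzz] : exists2 z, z \in K & (g ^+ p).1 z != 0%R.
  have /existsP[z nzz] : [exists z, (g ^+ p).1 z != 0%R].
    rewrite -negb_forall; apply: contra nzm => /forallP m00; apply/eqP/ffunP => z.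
    by rewrite ffunE; apply/eqP.
  by exists z => //; apply: contraR nzz => Kz; rewrite m0.
have Kxz : x ^ z^-1 \in K by rewrite groupJ ?groupV.
have [|Lxz lxz] := xL _ Kxz; first by rewrite orderJ.
case/eqP: lxz; apply: (mulIf nzz); rewrite mul1r -mL // conjgE invgK mulgA mulgKV.
by rewrite -[RHS](congr1 (fun h : {ffun gT -> 'F_r} => h z) fix_x) ffunE.
Qed.

(* When L = K an equivariant function is determined by its value at 1. *)
Definition coordinate (u : W) : 'F_r := u.1 1.

(** In general the second term carries the factor [lam (project u)]. *)
Lemma coordinateM u v : L = K -> v \in extension -> project u \in K -> lam (project u) = 1%R ->
  coordinate (u * v) = (coordinate u + coordinate v)%R.
Proof.
move=> LK; rewrite in_extension => /andP[/equivariantP[_ vL] _] Ku lu1.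
by rewrite /coordinate wreathM1 !ffunE mul1g -[u.2]mulg1 vL ?LK // -/(project u) lu1 mul1r.
Qed.

Lemma coordinate_neq0 u : L = K -> u \in extension -> project u = 1 -> u != 1 -> coordinate u != 0%R.
Proof.
move=> LK; rewrite in_extension => /andP[/equivariantP[u0 uL] _] u1; apply: contra => /eqP cu0.
rewrite [u]surjective_pairing -/(project u) u1; apply/eqP; congr pair; apply/ffunP => z.
rewrite ffunE; have [Kz|] := boolP (z \in K); last exact: u0.
by rewrite -[z]mulg1 uL ?LK // -/(coordinate u) cu0 mulr0.
Qed.

Lemma extension_dvd_r : r %| #|extension|.
Proof.
have [|f Ef [nzf _]] := exists_fixed_equivariant (group1 K).
  by move=> z _; rewrite cycle1 => /set1P->.
have Km : ((f, 1) : W) \in extension by rewrite in_extension Ef group1.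
have om : #[(f, 1) : W] = r.
  apply: nt_prime_order => //; first exact: kernel_expr.
  by apply: contra nzf => /eqP[->].
by have := order_dvdG Km; rewrite om.
Qed.

End Extension.

(** * Realisation of graphs *)

Lemma Zp_natM n (x y : 'Z_n) : 0 < n -> (x * y)%g = x + y %[mod n].
Proof. by case: n x y => [|[|n]] // x y _; rewrite ?modn1 //; apply: modn_mod. Qed.

Lemma Fp_natD p (a b : 'F_p) : prime p -> (a + b)%R = a + b %[mod p].
Proof.
move=> p_pr; have -> : (a + b)%R = ((nat_of_ord a + nat_of_ord b)%N%:R)%R :> 'F_p.
  by rewrite natrD !natr_Zp.
by rewrite val_Fp_nat // modn_mod.
Qed.

Section Realisation.

Variables (X : finType) (nadj : rel X) (col lab : X -> nat).
Hypotheses (nadjC : symmetric nadj) (nadj_col : forall u v, nadj u v -> col u != col v)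
  (col3 : forall v, col v < 3) (nadj_tri : forall u v w, nadj u v -> nadj v w -> ~~ nadj u w).
Hypotheses (lab_pr : forall v, prime (lab v)) (lab_inj : injective lab).

(* Sets of colour 0 vertices are encoded by squarefree numbers, so that inclusion becomes
   divisibility. *)
Definition part (P : pred X) := (\prod_(u | (col u == 0%N) && P u) lab u)%N.
Local Notation NO := (part predT).

(** The field of order [lab v] then contains the roots of unity that serve as values of [lam]. *)
Hypothesis lab0 : forall v, col v != 0%N -> NO %| (lab v).-1.
Hypothesis lab1 : forall u v, col u = 1%N -> col v = 2 -> lab u %| (lab v).-1.

Lemma part_gt0 P : 0 < part P.
Proof. by apply: prodn_gt0 => u; apply: prime_gt0. Qed.

Lemma part_dvd (P Q : pred X) : (forall u, P u -> Q u) -> part P %| part Q.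
Proof.
move=> PQ; rewrite [part Q](bigID P) /=.
suffices -> : (\prod_(i | (col i == 0) && Q i && P i) lab i)%N = part P by apply: dvdn_mulr.
apply: eq_bigl => u; rewrite -andbA; congr (_ && _).
by apply/andP/idP => [[]//|Pu]; split=> //; apply: PQ.
Qed.

Lemma lab_part (P : pred X) v : col v = 0%N -> P v -> lab v %| part P.
Proof. by move=> cv Pv; rewrite /part (bigD1 v) ?cv //= dvdn_mulr. Qed.

Lemma coprime_lab u v : u != v -> coprime (lab u) (lab v).
Proof. by move=> uv; rewrite prime_coprime // dvdn_prime2 // (inj_eq lab_inj). Qed.

Lemma coprime_lab_part (P : pred X) v : (col v == 0%N) && P v = false -> coprime (lab v) (part P).
Proof.
move=> Pv; rewrite /part; elim/big_ind: _ => [|m n cm cn|u Pu]; first exact: coprimen1.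
  by rewrite coprimeMr cm.
by apply: coprime_lab; apply: contraFneq Pv => ->.
Qed.

(** * Invariants of the construction and their preservation when a vertex is added *)

Section Invariants.

Variables (gT : finGroupType) (K : {group gT}) (cf : gT -> nat) (bf : X -> gT -> nat) (S : {set X}).

Definition prime_graph_inv : Prop :=
  [/\ solvable K,
      forall p, prime p -> (p %| #|K|) = [exists v in S, lab v == p] &
      forall u v, u \in S -> v \in S -> u != v -> no_order K (lab u * lab v)%N <-> nadj u v].

(* cf is the projection onto the cyclic quotient Z/NO of K. On the elements whose image has no part
   at the vertices u with nadj u v, bf v is a homomorphism to Z/(lab v). *)
Definition base_inv : Prop :=
  {in K &, forall x y, cf (x * y) = cf x + cf y %[mod NO]} /\
  (forall v x, col v = 0%N -> x \in K -> #[x] = lab v -> ~~ (NO %| cf x)).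

Definition middle_inv : Prop := forall v, v \in S -> col v = 1%N ->
  {in K &, forall x y, part (nadj^~ v) %| cf x -> bf v (x * y) = bf v x + bf v y %[mod lab v]} /\
  (forall x, x \in K -> #[x] = lab v -> ~~ (lab v %| bf v x)).

End Invariants.

Section Coordinates.

Variables (gT : finGroupType) (K : {group gT}) (cf : gT -> nat) (bf : X -> gT -> nat) (S : {set X}).
Hypotheses (graphK : prime_graph_inv K S) (baseK : base_inv K cf) (middleK : middle_inv K cf bf S).


Lemma modn_double m n : n = n + n %[mod m] -> m %| n.
Proof. by rewrite -[n in LHS]addn0 => /eqP; rewrite eqn_modDl eq_sym mod0n. Qed.

Lemma cf1 : NO %| cf 1.
Proof. by have [cM _] := baseK; apply: modn_double; rewrite -cM // mulg1. Qed.

Lemma cfX x k : x \in K -> cf (x ^+ k) = k * cf x %[mod NO].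
Proof.
move=> Kx; have [cM _] := baseK; elim: k => [|k IH].
  by rewrite expg0 mul0n mod0n; apply/eqP/cf1.
by rewrite expgS cM ?groupX // -modnDmr IH modnDmr mulSn.
Qed.

Lemma cf_order x v : x \in K -> #[x] = lab v -> NO %| lab v * cf x.
Proof.
move=> Kx ox; rewrite /dvdn -cfX // -ox expg_order; exact: cf1.
Qed.

(** In Z/NO the element [cf x] is killed by the prime [lab v], so only its component at [v] can be
    nonzero; if [v] has colour 0, it is nonzero by [base_inv]. *)
Lemma part_cf (P : pred X) x v : x \in K -> #[x] = lab v ->
  (part P %| cf x) = ~~ ((col v == 0%N) && P v).
Proof.
move=> Kx ox; have NOx := cf_order Kx ox; have [_ c0] := baseK.
have [Pv|nPv] := boolP ((col v == 0%N) && P v); last first.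
  rewrite -(Gauss_dvdr _ (_ : coprime (part P) (lab v))); last first.
    by rewrite coprime_sym coprime_lab_part ?(negPf nPv).
  by apply: dvdn_trans NOx; apply: part_dvd.
have /andP[/eqP cv Pv'] := Pv; apply/negP => Px.
have lx : lab v %| cf x := dvdn_trans (lab_part cv Pv') Px.
have := c0 v x cv Kx ox; rewrite /part (bigD1 v) ?cv //= Gauss_dvd ?lx /=; last first.
  have := @coprime_lab_part (fun u => u != v) v; rewrite eqxx andbF => /(_ erefl).
  by rewrite /part; congr coprime; apply: eq_bigl => u; rewrite andbT.
case/negP; have := NOx; rewrite /part (bigD1 v) ?cv //= dvdn_pmul2l //.
by apply: prime_gt0.
Qed.

Lemma bf1 w : w \in S -> col w = 1%N -> lab w %| bf w 1.
Proof.
move=> Sw cw; have [bM _] := middleK Sw cw; apply: modn_double; rewrite -bM // ?mulg1 //.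
by apply: dvdn_trans cf1; apply: part_dvd.
Qed.

Lemma bf_order w x v : w \in S -> col w = 1%N -> x \in K -> #[x] = lab v -> w != v ->
  part (nadj^~ w) %| cf x -> lab w %| bf w x.
Proof.
move=> Sw cw Kx ox wv dx; have [bM _] := middleK Sw cw.
have b1 := bf1 Sw cw.
have bX k : bf w (x ^+ k) = k * bf w x %[mod lab w].
  elim: k => [|k IH]; first by rewrite expg0 mul0n mod0n; apply/eqP.
  by rewrite expgS bM ?groupX // -modnDmr IH modnDmr mulSn.
rewrite -(Gauss_dvdr _ (coprime_lab wv)) /dvdn -bX -ox expg_order; exact: b1.
Qed.

Section Step.

Variables (v : X) (L : {group gT}) (lam : gT -> 'F_(lab v)).
Hypotheses (nSv : v \notin S) (nLK : L <| K)
  (lamM : {in L &, forall x y, lam (x * y) = lam x * lam y}%R) (lam1 : lam 1 = 1%R).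
Hypothesis lam_nadj : forall u, u \in S -> nadj u v ->
  forall x, x \in K -> #[x] = lab u -> x \in L /\ lam x != 1%R.
Hypothesis lam_adj : forall u, u \in S -> ~~ nadj u v ->
  forall x, x \in K -> #[x] = lab u -> x \notin L \/ lam x = 1%R.

Let r_pr : prime (lab v) := lab_pr v.
Let E := extension K L lam.

Lemma rK : ~~ (lab v %| #|K|).
Proof.
have [_ dvK _] := graphK; rewrite dvK //.
by apply: contra nSv => /exists_inP[u Su /eqP/lab_inj uv]; rewrite -uv.
Qed.

Lemma neq_v u : u \in S -> u != v.
Proof. by apply: contraTneq => ->. Qed.

Lemma lab_neq_v u : u \in S -> lab u != lab v.
Proof. by move=> Su; rewrite (inj_eq lab_inj) neq_v. Qed.

Lemma step_edge u : u \in S -> no_order E (lab u * lab v)%N <-> nadj u v.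
Proof.
move=> Su; have uv := lab_neq_v Su; have u_pr := lab_pr u; split=> [noE|nuv]; last first.
  exact: (@extension_nonadj _ K L (lab v) lam r_pr rK (lab u) u_pr uv (lam_nadj Su nuv)).
apply: contraT => nuv; have [_ dvK _] := graphK.
have [|x Kx ox] := @Cauchy _ (lab u) K u_pr; first by rewrite dvK //; apply/exists_inP; exists u.
by case: (extension_adj r_pr rK nLK lamM lam1 u_pr uv Kx ox (lam_adj Su nuv Kx ox) noE).
Qed.

Lemma step_graph : prime_graph_inv E (v |: S).
Proof.
have [solK dvK edgeK] := graphK; split; first exact: extension_sol.
  move=> p p_pr; apply/idP/exists_inP => [/(extension_prime r_pr p_pr)[->|]|[u]].
  - by exists v; rewrite ?setU11.
  - by rewrite dvK // => /exists_inP[u Su up]; exists u; rewrite // inE Su orbT.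
  rewrite in_setU1 => /predU1P[->|Su] /eqP up.
    by rewrite -up; apply: (extension_dvd_r r_pr rK nLK lamM lam1).
  by apply: extension_dvd => //; rewrite dvK //; apply/exists_inP; exists u; rewrite ?up.
move=> u w; rewrite !in_setU1 => /predU1P[->|Su] /predU1P[->|Sw]; first by rewrite eqxx.
- by move=> _; rewrite mulnC nadjC; apply: step_edge.
- by move=> _; apply: step_edge.
move=> uw; apply: iff_trans (no_order_extension K L lam r_pr _) (edgeK u w Su Sw uw).
by rewrite coprimeMl !coprime_lab ?neq_v.
Qed.

Definition cf_step (g : wreath gT (lab v)) := cf (project g).

Lemma step_base : col v != 0%N -> base_inv E cf_step.
Proof.
move=> cv; have [cM c0] := baseK; split=> [x y Ex Ey|w x cw Ex ox].
  by rewrite /cf_step projectM cM ?(project_in Ex) ?(project_in Ey).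
apply: (c0 w) => //; first exact: project_in Ex.
apply: (order_project r_pr) => //; rewrite (inj_eq lab_inj).
by apply: contraNneq cv => <-; rewrite cw.
Qed.

Definition bf_step (w : X) (g : wreath gT (lab v)) : nat :=
  if w == v then nat_of_ord (coordinate g) else bf w (project g).

Lemma step_middle_old w : w \in S -> col w = 1%N ->
  {in E &, forall x y, part (nadj^~ w) %| cf_step x ->
     bf_step w (x * y) = bf_step w x + bf_step w y %[mod lab w]} /\
  (forall x, x \in E -> #[x] = lab w -> ~~ (lab w %| bf_step w x)).
Proof.
move=> Sw cw; have [bM b0] := middleK Sw cw; rewrite /bf_step (negPf (neq_v Sw)).
split=> [x y Ex Ey dx|x Ex ox].
  by rewrite projectM bM ?(project_in Ex) ?(project_in Ey).
apply: b0; first exact: project_in Ex.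
exact: (order_project r_pr (lab_pr w) (lab_neq_v Sw)).
Qed.

(** The coordinate at 1 is additive where [lam] is 1. An element of order [lab v] lies in the
    module, and for [L = K] a nonzero equivariant function does not vanish at 1. *)
Lemma step_middle_new : L = K -> (forall x, x \in K -> part (nadj^~ v) %| cf x -> lam x = 1%R) ->
  {in E &, forall x y, part (nadj^~ v) %| cf_step x ->
     bf_step v (x * y) = bf_step v x + bf_step v y %[mod lab v]} /\
  (forall x, x \in E -> #[x] = lab v -> ~~ (lab v %| bf_step v x)).
Proof.
move=> LK lam_d; rewrite /bf_step eqxx; split=> [x y Ex Ey dx|x Ex ox].
  have Kx := project_in Ex; rewrite (coordinateM LK Ey Kx (lam_d _ Kx dx)).
  exact: Fp_natD.
have x1 := order_kernel r_pr rK Ex ox.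
have ntx : x != 1 by rewrite -order_gt1 ox prime_gt1.
have := coordinate_neq0 LK Ex x1 ntx; apply: contra.
by rewrite (dvdn_pcharf (pchar_Fp r_pr)) natr_Zp.
Qed.

End Step.

End Coordinates.

Definition realised (S : {set X}) : Prop :=
  exists (gT : finGroupType) (K : {group gT}) (cf : gT -> nat) (bf : X -> gT -> nat),
    [/\ prime_graph_inv K S, base_inv K cf & middle_inv K cf bf S].

Lemma root_exprD n N (F : fieldType) (z : F) a b c : n.-primitive_root%R z -> n %| N ->
  a = b + c %[mod N] -> (z ^+ a = z ^+ b * z ^+ c)%R.
Proof.
move=> prim_z nN abc; rewrite -exprD; apply/eqP; rewrite (eq_prim_root_expr prim_z).
by rewrite -(modn_dvdm a nN) abc modn_dvdm.
Qed.

Lemma realised_base : realised [set v | col v == 0%N].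
Proof.
have NO_gt0 := part_gt0 predT; have cK := card_Zp NO_gt0.
exists _, (Zp NO), (fun x : 'Z_NO => nat_of_ord x), (fun _ _ => 0%N); split.
- split=> [|p p_pr|u w].
  + by apply: abelian_sol; apply: (abelianS (subsetT _)); exact: Zp_abelian.
  + rewrite cK Euclid_dvd_prod // big_orE; apply/existsP/exists_inP => [[u /andP[/andP[cu _] pu]]|[u]].
      by exists u; rewrite ?inE // eq_sym -dvdn_prime2.
    by rewrite inE => cu /eqP<-; exists u; rewrite cu /=.
  rewrite !inE => /eqP cu /eqP cw uw; have nuw : ~~ nadj u w.
    by apply/negP => /nadj_col; rewrite cu cw.
  split=> [noK|/(negP nuw)//]; exfalso.
  have dNO : lab u * lab w %| NO by rewrite Gauss_dvd ?coprime_lab // !lab_part.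
  (* The type ['Z_1] has two elements, and [Zp NO] is the whole type only for [NO > 1]. *)
  have NO_gt1 : 1 < NO.
    apply: leq_trans (dvdn_leq NO_gt0 dNO); apply: leq_trans (prime_gt1 (lab_pr u)) _.
    by rewrite leq_pmulr ?prime_gt0.
  have oZ : #[Zp1 : 'Z_NO] = NO by rewrite order_Zp1 Zp_cast.
  have KZ : (Zp1 : 'Z_NO) ^+ (NO %/ (lab u * lab w)) \in Zp NO by rewrite /Zp NO_gt1 inE.
  case/eqP: (noK _ KZ).
  by rewrite orderXdiv oZ ?dvdn_div // divnA // mulKn.
- split=> [x y _ _|v x cv Kx ox]; first exact: Zp_natM.
  have NO_gt1 : 1 < NO.
    apply: leq_trans (prime_gt1 (lab_pr v)) (dvdn_leq NO_gt0 _); exact: lab_part.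
  rewrite gtnNdvd //; last by rewrite -{2}(Zp_cast NO_gt1) ltn_ord.
  rewrite lt0n; apply: contraTneq (prime_gt1 (lab_pr v)) => x0.
  by rewrite -ox order_gt1 negbK; apply/eqP/val_inj.
by move=> v; rewrite inE => /eqP->.
Qed.

(** The character is [w ^ cf], where the order of [w] is the product of the labels of the colour 0
    vertices nonadjacent to [v]. As [S] has no vertex of colour 2, it detects all vertices of [S]
    nonadjacent to [v]. *)
Lemma realised_middle S v : realised S -> {in S, forall u, col u != 2} -> v \notin S -> col v = 1%N ->
  realised (v |: S).
Proof.
case=> gT [K [cf [bf [graphK baseK middleK]]]] S2 nSv cv.
have dNO : part (nadj^~ v) %| NO by apply: part_dvd.
have [|w prim_w] := exists_primitive_root_Fp (lab_pr v) (part_gt0 (nadj^~ v)).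
  by apply: dvdn_trans dNO _; apply: lab0; rewrite cv.
pose lam (x : gT) : 'F_(lab v) := (w ^+ cf x)%R.
have lam_dvd x : (lam x == 1%R) = (part (nadj^~ v) %| cf x) by rewrite (prim_order_dvd prim_w).
have lamM : {in K &, forall x y, lam (x * y) = (lam x * lam y)%R}.
  by have [cM _] := baseK => x y Kx Ky; apply: (root_exprD prim_w dNO); apply: cM.
have lam1 : lam 1 = 1%R by apply/eqP; rewrite lam_dvd (dvdn_trans dNO) // (cf1 baseK).
have lam_nadj u : u \in S -> nadj u v ->
    forall x, x \in K -> #[x] = lab u -> x \in K /\ lam x != 1%R.
  move=> Su nuv x Kx ox; split=> //; rewrite lam_dvd (part_cf baseK _ Kx ox) nuv andbT negbK.
  move: (nadj_col nuv) (S2 u Su) (col3 u); rewrite cv.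
  by case: (col u) => [|[|[|]]].
have lam_adj u : u \in S -> ~~ nadj u v ->
    forall x, x \in K -> #[x] = lab u -> x \notin K \/ lam x = 1%R.
  move=> Su nuv x Kx ox; right; apply/eqP.
  by rewrite lam_dvd (part_cf baseK _ Kx ox) (negPf nuv) andbF.
exists _, (extension K K lam), (@cf_step _ cf v), (@bf_step _ bf v); split.
- exact: (step_graph graphK nSv (normal_refl K) lamM lam1 lam_nadj lam_adj).
- by apply: step_base; rewrite ?cv.
move=> u; rewrite in_setU1; case/predU1P=> [->|Su] cu.
  apply: (step_middle_new bf graphK nSv (erefl K)).
  move=> x Kx dx.
  by apply/eqP; rewrite lam_dvd.
exact: (step_middle_old middleK K lam nSv Su cu).
Qed.

Lemma realised_top S v : realised S -> v \notin S -> col v = 2 -> realised (v |: S).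
Proof.
case=> gT [K [cf [bf [graphK baseK middleK]]]] nSv cv.
have [cM c0] := baseK.
pose Q := part (fun u => ~~ nadj u v).
have QNO : Q %| NO by apply: part_dvd.
have cMQ x y : x \in K -> y \in K -> cf (x * y) = cf x + cf y %[mod Q].
  by move=> Kx Ky; rewrite -(modn_dvdm _ QNO) cM // modn_dvdm.
pose Lset := [set x in K | Q %| cf x].
have gL : group_set Lset.
  apply/group_setP; split=> [|x y].
    by rewrite inE group1 (dvdn_trans QNO) // (cf1 baseK).
  rewrite !inE => /andP[Kx dx] /andP[Ky dy]; rewrite groupM //=.
  by rewrite /dvdn cMQ // -/(dvdn Q (cf x + cf y)) dvdn_add.
pose L := Group gL.
have sLK : L \subset K by apply/subsetP => x; rewrite inE => /andP[].
have nLK : L <| K.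
  apply/andP; split=> //; apply/normsP => y Ky; apply/eqP; rewrite eqEcard cardJg leqnn andbT.
  apply/subsetP => _ /imsetP[x /[swap] -> /setIdP[Kx dx]]; rewrite inE groupJ //=.
  (* Additivity makes [cf] invariant under conjugation modulo [Q]. *)
  have := cMQ y (x ^ y) Ky (groupJ Kx Ky); rewrite -conjgC cMQ // addnC => /eqP.
  by rewrite eqn_modDl => /eqP; rewrite /dvdn => <-.
have [|eta prim_eta] := exists_primitive_root_Fp (lab_pr v) (part_gt0 predT).
  by apply: lab0; rewrite cv.
have [zeta prim_zeta] : exists z : X -> 'F_(lab v), forall w, col w = 1%N ->
    (lab w).-primitive_root%R (z w).
  apply: (@fin_all_exists X (fun=> 'F_(lab v))
    (fun w z => col w = 1%N -> (lab w).-primitive_root%R z)) => w.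
  have [cw|cw] := eqVneq (col w) 1%N; last by exists 0%R => /eqP; rewrite (negPf cw).
  have [|z] := exists_primitive_root_Fp (lab_pr v) (prime_gt0 (lab_pr w)); first exact: lab1.
  by exists z.
pose D w := [&& w \in S, col w == 1%N & nadj w v].
(* Triangle freeness: [nadj u w] and [nadj w v] exclude [nadj u v]. So on [L] each [bf w] occurring
   in [lam] is additive. *)
have DQ w : D w -> part (nadj^~ w) %| Q.
  by case/and3P=> _ _ nwv; apply: part_dvd => u nuw; apply: nadj_tri nuw nwv.
(* [eta] detects the nonadjacent vertices of colour 0, and [zeta w] the single vertex [w] of colour
   1. *)
pose lam (x : gT) : 'F_(lab v) := (eta ^+ cf x * \prod_(w | D w) zeta w ^+ bf w x)%R.
have lamM : {in L &, forall x y, lam (x * y) = (lam x * lam y)%R}.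
  move=> x y; rewrite !inE => /andP[Kx dx] /andP[Ky dy]; rewrite /lam.
  rewrite (root_exprD prim_eta (dvdnn _) (cM x y Kx Ky)).
  rewrite mulrACA -big_split /=; congr (_ * _)%R; apply: eq_bigr => w Dw.
  case/and3P: (Dw) => Sw /eqP cw nwv; have [bM _] := middleK w Sw cw.
  apply: (root_exprD (prim_zeta w cw) (dvdnn _)); apply: bM => //.
  exact: dvdn_trans (DQ w Dw) dx.
have eta_v x : (eta ^+ cf x == 1)%R = (NO %| cf x) by rewrite (prim_order_dvd prim_eta).
have eta1 x : NO %| cf x -> (eta ^+ cf x = 1)%R by rewrite -eta_v => /eqP.
have zeta_w w x : D w -> (zeta w ^+ bf w x == 1)%R = (lab w %| bf w x).
  by case/and3P=> _ /eqP cw _; rewrite (prim_order_dvd (prim_zeta w cw)).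
have lam1 : lam 1 = 1%R.
  rewrite /lam eta1 ?(cf1 baseK) // mul1r big1 // => w Dw.
  apply/eqP; rewrite zeta_w //; case/and3P: Dw => Sw /eqP cw _.
  exact: (bf1 baseK middleK).
have zeta_other u x w : x \in L -> #[x] = lab u -> D w -> w != u -> (zeta w ^+ bf w x = 1)%R.
  rewrite inE => /andP[Kx dx] ox Dw wu; apply/eqP; rewrite zeta_w //.
  case/and3P: (Dw) => Sw /eqP cw _.
  by apply: (bf_order baseK middleK Sw cw Kx ox wu); apply: dvdn_trans (DQ w Dw) dx.
have inL u x : x \in K -> #[x] = lab u -> (x \in L) = ~~ ((col u == 0%N) && ~~ nadj u v).
  by move=> Kx ox; rewrite inE Kx /= (part_cf baseK _ Kx ox).
have lam_nadj u : u \in S -> nadj u v ->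
    forall x, x \in K -> #[x] = lab u -> x \in L /\ lam x != 1%R.
  move=> Su nuv x Kx ox; have Lx : x \in L by rewrite (inL u) // nuv andbF.
  split=> //; have [cu|cu] := eqVneq (col u) 0%N.
    rewrite /lam big1 ?mulr1 ?eta_v ?(c0 u) // => w Dw; apply: (zeta_other u) => //.
    by apply: contraTneq Dw => ->; rewrite /D cu andbF.
  have cu1 : col u = 1%N.
    by move: cu (nadj_col nuv) (col3 u); rewrite cv; case: (col u) => [|[|[|]]].
  have Du : D u by rewrite /D Su cu1 eqxx.
  rewrite /lam eta1 ?(part_cf baseK _ Kx ox) ?cu1 // mul1r (bigD1 u) //=.
  rewrite big1 ?mulr1 => [|w /andP[Dw wu]]; last exact: (zeta_other u).
  by rewrite zeta_w //; have [_] := middleK u Su cu1; apply.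
(* An adjacent vertex of colour 0 is excluded by [L]; at the others every factor of [lam] is 1. *)
have lam_adj u : u \in S -> ~~ nadj u v ->
    forall x, x \in K -> #[x] = lab u -> x \notin L \/ lam x = 1%R.
  move=> Su nuv x Kx ox; have [cu|cu] := eqVneq (col u) 0%N.
    by left; rewrite (inL u) // cu nuv.
  right; rewrite /lam eta1 ?(part_cf baseK _ Kx ox) ?(negPf cu) // mul1r.
  apply: big1 => w Dw; apply: (zeta_other u) => //; first by rewrite (inL u) // (negPf cu).
  by apply: contraNneq nuv => <-; case/and3P: Dw.
exists _, (extension K L lam), (@cf_step _ cf v), (@bf_step _ bf v); split.
- exact: (step_graph graphK nSv nLK lamM lam1 lam_nadj lam_adj).
- by apply: step_base; rewrite ?cv.
move=> u; rewrite in_setU1 => /predU1P[->|Su] cu; first by rewrite cu in cv.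
exact: (step_middle_old middleK L lam nSv Su cu).
Qed.

Lemma realised_all : realised [set: X].
Proof.
pose C i := [seq v <- enum X | col v == i].
have memC i v : (v \in C i) = (col v == i) by rewrite mem_filter mem_enum andbT.
have middle : realised ([set v | col v == 0%N] :|: [set v in C 1%N]).
  have: all (fun v => col v == 1%N) (C 1%N) by apply: filter_all.
  elim: (C 1%N) => [_|v s IH /= /andP[/eqP cv /[dup] s1 /IH rs]].
    rewrite (_ : [set v in [::]] = set0) ?setU0; first exact: realised_base.
    by apply/setP => v; rewrite !inE.
  rewrite set_cons setUCA; set S := _ :|: _ in rs *.
  have [Sv|nSv] := boolP (v \in S); first by rewrite (setUidPr _) ?sub1set.
  apply: realised_middle => // u; rewrite !inE => /orP[/eqP->//|/(allP s1)/eqP->//].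
have: realised ([set v | col v == 0%N] :|: [set v in C 1%N] :|: [set v in C 2]).
  have: all (fun v => col v == 2) (C 2) by apply: filter_all.
  elim: (C 2) => [_|v s IH /= /andP[/eqP cv /IH rs]].
    by rewrite (_ : [set v in [::]] = set0) ?setU0 //; apply/setP => v; rewrite !inE.
  rewrite set_cons setUCA; set S := _ :|: _ in rs *.
  have [Sv|nSv] := boolP (v \in S); first by rewrite (setUidPr _) ?sub1set.
  exact: realised_top.
congr realised; apply/setP => v; rewrite !inE !memC.
by move: (col3 v); case: (col v) => [|[|[|]]].
Qed.

End Realisation.

(** * Choice of the labels and the final equivalence *)

Lemma backward (Y : sgraph) : colorable 3 (compl_graph Y) -> triangle_free (compl_graph Y) ->
  exists (gT : finGroupType) (G : {group gT}),
    pseudo_U42_solvable G /\ graph_iso Y (prime_graph G).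
Proof.
case=> c cP triY; pose nadj := @compl_adj Y.
have nadjC : symmetric nadj := @compl_adj_sym Y.
pose col v := nat_of_ord (c v); have col3 v : col v < 3 by apply: ltn_ord.
have nadj_col u v : nadj u v -> col u != col v by move=> /cP; apply: contra => /eqP/val_inj->.
have nadj_tri u v w : nadj u v -> nadj v w -> ~~ nadj u w.
  by move=> uv vw; have := triY u v w; rewrite /= -!/(nadj _ _) uv vw.
(* The colours are labelled in turn. [N0] and [N1] divide the predecessors of the labels chosen
   next, and [f0 <= N0 < f1 <= N1 < f2] on the respective colours keeps all labels distinct. *)
have [f0 [inj0 pr0 _ _]] := prime_labelling [pred v | col v == 0%N] 1 (isT : 0 < 1).
pose N0 := (\prod_(u | col u == 0%N) f0 u)%N.
have N0_gt0 : 0 < N0 by apply: prodn_gt0 => u; apply: prime_gt0.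
have [f1 [inj1 pr1 gt1 dv1]] := prime_labelling [pred v | col v == 1%N] N0 N0_gt0.
pose N1 := (N0 * \prod_(u | col u == 1%N) f1 u)%N.
have N1_gt0 : 0 < N1 by rewrite muln_gt0 N0_gt0; apply: prodn_gt0 => u; apply: prime_gt0.
have [f2 [inj2 pr2 gt2 dv2]] := prime_labelling [pred v | col v == 2] N1 N1_gt0.
pose lab v := if col v == 0%N then f0 v else if col v == 1%N then f1 v else f2 v.
have lab_pr v : prime (lab v) by rewrite /lab; do 2?case: ifP => _.
have NO_N0 : part col lab predT = N0.
  by apply: eq_big => [u|u /andP[cu _]]; rewrite ?andbT // /lab cu.
have lab_inj : injective lab.
  have le0 u : col u = 0%N -> f0 u <= N0.
    by move=> cu; apply: dvdn_leq => //; rewrite /N0 (bigD1 u) ?cu //= dvdn_mulr.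
  have le01 : N0 <= N1 by apply: dvdn_leq => //; apply: dvdn_mulr.
  have le1 u : col u = 1%N -> f1 u <= N1.
    by move=> cu; apply: dvdn_leq => //; rewrite /N1 (bigD1 u) ?cu //= mulnCA dvdn_mulr.
  move=> u v; rewrite /lab.
  move: (col3 u) (col3 v) (le0 u) (le0 v) (le1 u) (le1 v) (gt1 u) (gt1 v) (gt2 u) (gt2 v) le01.
  move: (inj0 u v) (inj1 u v) (inj2 u v); rewrite !inE.
  case: (col u) => [|[|[|//]]]; case: (col v) => [|[|[|//]]] //= i0 i1 i2 _ _ *;
    solve [exact: i0 | exact: i1 | exact: i2 | exfalso; lia].
have lab0 v : col v != 0%N -> part col lab predT %| (lab v).-1.
  rewrite NO_N0 /lab => /negPf->; case: ifP => _; first exact: dv1.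
  by apply: dvdn_trans (dv2 v); apply: dvdn_mulr.
have lab1 u v : col u = 1%N -> col v = 2 -> lab u %| (lab v).-1.
  rewrite /lab => cu ->; rewrite cu /=; apply: dvdn_trans (dv2 v).
  by rewrite /N1 (bigD1 u) ?cu //= mulnCA dvdn_mulr.
have [gT [K [_ [_ [[solK dvK edgeK] _ _]]]]] :=
  realised_all nadjC nadj_col col3 nadj_tri lab_pr lab_inj lab0 lab1.
exists gT, K; split; first exact: solvable_pseudo.
have memK v : lab v \in primes #|K|.
  by rewrite mem_primes lab_pr cardG_gt0 dvK //; apply/exists_inP; exists v; rewrite ?inE.
pose f v : prime_graph K := SeqSub (memK v).
exists f => [|u v].
  have inj_f : injective f by move=> u v /(congr1 val)/lab_inj.
  have surj_f (p : prime_graph K) : exists v, f v == p.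
    have := valP p; rewrite mem_primes => /and3P[p_pr _]; rewrite dvK // => /exists_inP[v _ lv].
    by exists v.
  exists (fun p => xchoose (surj_f p)) => [v|p]; last exact/eqP/(xchooseP (surj_f p)).
  by apply: inj_f; apply/eqP/(xchooseP (surj_f (f v))).
rewrite /= /prime_adj /= (inj_eq (_ : injective f)); last by move=> x y /(congr1 val)/lab_inj.
have [->|uv] := eqVneq u v; first by rewrite adj_irrefl.
have := edgeK u v (in_setT u) (in_setT v) uv; rewrite /nadj /compl_adj /= uv /= => E.
apply/exists_inP/idP => [[x Kx /eqP ox]|uvY].
  by apply: contraT => /E.2/(_ x Kx); rewrite ox eqxx.
apply/exists_inP; apply: contraT; rewrite negb_exists_in => /forall_inP noK.
by have := E.1 noK; rewrite uvY.
Qed.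

Theorem theorem4p8 (X : sgraph) :
  (exists (gT : finGroupType) (G : {group gT}),
      pseudo_U42_solvable G /\ graph_iso X (prime_graph G)) <->
  (colorable 3 (compl_graph X) /\ triangle_free (compl_graph X)).
Proof.
split=> [[gT [G [psG isoX]]]|[col3 tri]]; first exact: forward psG isoX.
exact: backward.
Qed.
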